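(* A curve $\gamma=(x,t)$ (with $x\ge0$, lying in the $xt$-plane) is the generating curve of a rotationally invariant $p$-minimal surface $\Sigma$ in the Heisenberg group $H_1$ if and only if either $t$ is a constant, and hence $\Sigma$ is a part of a horizontal plane, or $\gamma=(x,t)$ is given by $$x^2=\tilde s^2+c_2,\qquad t=m\tilde s\quad(t\text{ up to an additive constant}),$$ for some horizontal arc-length parameter $\tilde s$ and some $c_2,m\in\mathbb{R}$, $m\neq0$. In addition (in the second case), $E=m$, where $E$ is the energy of $\gamma$, and in terms of normal coordinates $(\bar s,\bar\theta)$ the two invariants of $\Sigma$ are $$\zeta_1(\bar\theta)=E\bar\theta\ \text{ up to an additive constant (so linear in }\bar\theta),\qquad \zeta_2(\bar\theta)=c_2\ \text{ (a constant)}.$$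
   Context: Heisenberg group: $H_1=\mathbb{R}^3$ with product $(x_1,y_1,z_1)\circ(x_2,y_2,z_2)=(x_1+x_2,y_1+y_2,z_1+z_2+y_1x_2-x_1y_2)$. Left-invariant fields: $\mathring e_1=\partial_x+y\partial_z$, $\mathring e_2=\partial_y-x\partial_z$, $T=\partial_z$. The contact bundle $\xi$ is spanned by $\mathring e_1,\mathring e_2$ and is the kernel of $\Theta=dz+x\,dy-y\,dx$; $J:\xi\to\xi$ is $J\mathring e_1=\mathring e_2$, $J\mathring e_2=-\mathring e_1$; $\nabla$ is the connection for which $\mathring e_1,\mathring e_2,T$ are parallel; the adapted metric makes $\mathring e_1,\mathring e_2,T$ orthonormal. Surfaces: $\Sigma\subset H_1$ is of class $C^2$ and $C^\infty$ on its regular part. A point $p\in\Sigma$ is singular if $T_p\Sigma=\xi_p$ and regular otherwise. On the regular part $e_1$ is a unit vector field (unique up to sign) spanning $T\Sigma\cap\xi$, $e_2=Je_1$, the $p$-mean curvature $H$ is defined by $\nabla_{e_1}e_2=-He_1$, and the $\alpha$-function is the function such that $\alpha e_2+T$ is tangent to $\Sigma$. $\Sigma$ is $p$-minimal if $H=0$ on the regular part. Set $\hat e_2=(\alpha e_2+T)/\sqrt{1+\alpha^2}$. Coordinates $(s,\theta)$ on (an open set of) the regular part are compatible if $e_1=\partial/\partial s$; then $a,b$ are defined by $\hat e_2=a\,\partial_s+b\,\partial_\theta$. Normal coordinates and invariants for such $p$-minimal surfaces: compatible coordinates $(s,\theta)$ are normal if $$\alpha=\frac{s+\zeta_1(\theta)}{(s+\zeta_1(\theta))^2+\zeta_2(\theta)},\quad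 a=0,\quad b=\frac{|\alpha|}{|s+\zeta_1(\theta)|\sqrt{1+\alpha^2}}$$ (where $s+\zeta_1=0$, $b$ is understood by continuity, i.e. $b=1/(|(s+\zeta_1)^2+\zeta_2|\sqrt{1+\alpha^2})$); the functions $\zeta_1,\zeta_2$ are then the invariants of $\Sigma$. Rotationally invariant surfaces: the surface generated by $\gamma(s)=(x(s),0,t(s))$, $x\ge0$, $x'^2+t'^2=1$, is $\Sigma(s,\theta)=(x(s)\cos\theta,x(s)\sin\theta,t(s))$. A horizontal generating curve is $\tilde\gamma(s)=(x(s)\cos\theta(s),x(s)\sin\theta(s),t(s))$ with $\theta(s)$ chosen so that $\tilde\gamma'\in\xi$, i.e. $t'+x^2\theta'=0$. A horizontal arc-length parameter $\tilde s$ is the arc-length parameter of $\tilde\gamma$ in the adapted metric, so $\frac{d\tilde s}{ds}=\frac{\sqrt{x^2x'^2+t'^2}}{x}$. One takes $e_1=\partial/\partial\tilde s$; with this choice $H=-\dfrac{x^3(x't''-x''t')+t'^3}{x(x^2x'^2+t'^2)^{3/2}}$. The energy in the $p$-minimal case is the constant $E=\dfrac{xt'}{\sqrt{x^2x'^2+t'^2}}$. *)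

(* Defs.v *)
From Stdlib Require Import Reals.
From Coquelicot Require Import Coquelicot.

Open Scope R_scope.

(* The Heisenberg group in its coordinates (x, y, z).  The same type is used
   for tangent vectors, in two ways: by their components in d/dx, d/dy, d/dz,
   and by their components in the left-invariant frame (e1ring, e2ring, Tvec). *)
Definition H1 : Type := (R * R * R)%type.

Definition px (p : H1) : R := fst (fst p).
Definition py (p : H1) : R := snd (fst p).
Definition pz (p : H1) : R := snd p.

Definition e1ring (p : H1) : H1 := (1, 0, py p).
Definition e2ring (p : H1) : H1 := (0, 1, - px p).
(* (0, 0, 1) in both descriptions. *)
Definition Tvec : H1 := (0, 0, 1).

Definition Theta (p w : H1) : R := pz w + px p * py w - py p * px w.

(* From components in d/dx, d/dy, d/dz to components in the frame. *)
Definition frame_coords (p w : H1) : H1 := (px w, py w, Theta p w).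

Lemma frame_coordsE (p w : H1) :
  plus (scal (px (frame_coords p w)) (e1ring p))
    (plus (scal (py (frame_coords p w)) (e2ring p))
          (scal (pz (frame_coords p w)) Tvec)) = w.
Proof.
destruct p as [[x y] z], w as [[a b] c].
unfold frame_coords, e1ring, e2ring, Tvec, Theta, px, py, pz; simpl.
change ((a * 1 + (b * 0 + (c + x * b - y * a) * 0),
         a * 0 + (b * 1 + (c + x * b - y * a) * 0),
         a * y + (b * - x + (c + x * b - y * a) * 1)) = (a, b, c)).
apply (f_equal2 (@pair (R * R) R)); [apply (f_equal2 (@pair R R))|]; ring.
Qed.

(* From here on every tangent vector is given by its components in the frame. *)
Definition in_xi (c : H1) : Prop := pz c = 0.
(* Only its values on xi matter. *)
Definition J (c : H1) : H1 := (- py c, px c, 0).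
Definition adapted_norm (c : H1) : R := sqrt (px c ^ 2 + py c ^ 2 + pz c ^ 2).

Definition velocity (c : R -> H1) (s : R) : H1 :=
  frame_coords (c s)
    (Derive (fun r => px (c r)) s,
     Derive (fun r => py (c r)) s,
     Derive (fun r => pz (c r)) s).

(* Surfaces are parametrized by maps X of two real variables. *)
Definition d_fst (X : R -> R -> H1) (u v : R) : H1 := velocity (fun r => X r v) u.
Definition d_snd (X : R -> R -> H1) (u v : R) : H1 := velocity (fun r => X u r) v.

Definition param_vector (X : R -> R -> H1) (u v a b : R) : H1 :=
  plus (scal a (d_fst X u v)) (scal b (d_snd X u v)).

Definition tangent (X : R -> R -> H1) (u v : R) (c : H1) : Prop :=
  exists a b : R, c = param_vector X u v a b.

Definition immersed (X : R -> R -> H1) (u v : R) : Prop :=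
  forall a b : R, param_vector X u v a b = zero -> a = 0 /\ b = 0.

Definition regular (X : R -> R -> H1) (u v : R) : Prop :=
  immersed X u v /\ ~ (forall c : H1, tangent X u v c <-> in_xi c).

Definition C1_field (W : R -> R -> H1) (u v : R) : Prop :=
  ex_diff_n (fun u' v' => px (W u' v')) 1 u v /\
  ex_diff_n (fun u' v' => py (W u' v')) 1 u v /\
  ex_diff_n (fun u' v' => pz (W u' v')) 1 u v.

(* e is, near (u, v), a choice of the field e_1: at a regular point the
   intersection of the tangent plane with xi is a line. *)
Definition char_field (X : R -> R -> H1) (e : R -> R -> H1) (u v : R) : Prop :=
  locally_2d (fun u' v' =>
    tangent X u' v' (e u' v') /\ in_xi (e u' v') /\
    adapted_norm (e u' v') = 1 /\ C1_field e u' v') u v.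

(* Covariant derivative, in the direction param_vector X u v a b, of a field W
   along X: the frame is parallel, so its components are differentiated. *)
Definition nabla (W : R -> R -> H1) (u v a b : R) : H1 :=
  let D (f : H1 -> R) :=
    a * Derive (fun r => f (W r v)) u + b * Derive (fun r => f (W u r)) v in
  (D px, D py, D pz).

Definition p_mean_curvature (X : R -> R -> H1) (e : R -> R -> H1) (u v h : R)
  : Prop :=
  exists a b : R,
    e u v = param_vector X u v a b /\
    nabla (fun u' v' => J (e u' v')) u v a b = scal (- h) (e u v).

(* The choice of the sign of e_1 is irrelevant for H = 0. *)
Definition p_minimal (D : R -> R -> Prop) (X : R -> R -> H1) : Prop :=
  forall u v : R, D u v -> regular X u v ->
  exists e : R -> R -> H1, char_field X e u v /\ p_mean_curvature X e u v 0.

Definition connected_set (V : R * R -> Prop) : Prop :=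
  forall A B : R * R -> Prop, open A -> open B ->
  (forall p, V p -> A p \/ B p) ->
  (exists p, V p /\ A p) -> (exists p, V p /\ B p) ->
  exists p, V p /\ A p /\ B p.

(* Local coordinates on a piece Y(V) of a regular surface, given by the inverse
   Y of the coordinate map. *)
Definition coordinate_patch (V : R * R -> Prop) (Y : R -> R -> H1) : Prop :=
  open V /\ connected_set V /\
  (forall u v, V (u, v) -> forall n : nat,
     ex_diff_n (fun u' v' => px (Y u' v')) n u v /\
     ex_diff_n (fun u' v' => py (Y u' v')) n u v /\
     ex_diff_n (fun u' v' => pz (Y u' v')) n u v) /\
  (forall u v u' v', V (u, v) -> V (u', v') -> Y u v = Y u' v' ->
     u = u' /\ v = v') /\
  (forall u v, V (u, v) -> regular Y u v).

(* e_1 = d/ds is then a unit vector of the line (tangent plane) /\ xi. *)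
Definition compatible (V : R * R -> Prop) (Y : R -> R -> H1) : Prop :=
  forall s th, V (s, th) ->
    in_xi (d_fst Y s th) /\ adapted_norm (d_fst Y s th) = 1.

Definition is_alpha (Y : R -> R -> H1) (s th alpha : R) : Prop :=
  tangent Y s th (plus (scal alpha (J (d_fst Y s th))) Tvec).

Definition e2hat (Y : R -> R -> H1) (s th alpha : R) : H1 :=
  scal (/ sqrt (1 + alpha ^ 2)) (plus (scal alpha (J (d_fst Y s th))) Tvec).

(* The formula for b is |alpha| / (|s + zeta1| sqrt (1 + alpha^2)), simplified
   by means of the formula for alpha so that it also covers s + zeta1 = 0. *)
Definition normal_coordinates (V : R * R -> Prop) (Y : R -> R -> H1)
    (zeta1 zeta2 : R -> R) : Prop :=
  coordinate_patch V Y /\ compatible V Y /\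
  forall s th, V (s, th) ->
    let den := (s + zeta1 th) ^ 2 + zeta2 th in
    den <> 0 /\
    exists alpha a b : R,
      is_alpha Y s th alpha /\
      e2hat Y s th alpha = param_vector Y s th a b /\
      alpha = (s + zeta1 th) / den /\
      a = 0 /\
      b = 1 / (Rabs den * sqrt (1 + alpha ^ 2)).

(* Generating curves s |-> (x s, 0, t s), s in I *)

Definition interval (I : R -> Prop) : Prop :=
  (forall a b c, I a -> I b -> a <= c <= b -> I c) /\
  (exists a b, I a /\ I b /\ a < b).

Definition C2_near (f : R -> R) (s : R) : Prop :=
  locally s (fun r =>
    (forall k, (k <= 2)%nat -> ex_derive_n f k r) /\ continuous (Derive_n f 2) r).

Definition Cinf_near (f : R -> R) (s : R) : Prop :=
  locally s (fun r => forall k, ex_derive_n f k r).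

(* I may contain its end points: the curve then extends a little beyond them,
   but it is only required to stay in x >= 0 on I.  Since the derivatives at an
   end point are limits of the derivatives inside I, the extension plays no
   role.  The surface is C^2, and C^oo off the axis, where its regular part
   lies: at a point of the axis the tangent plane of a C^2 surface of
   revolution is horizontal, i.e. equal to xi.  The last clause only discards
   the case where the whole curve lies on the axis, which generates no
   surface. *)
Definition generating_curve (I : R -> Prop) (x t : R -> R) : Prop :=
  interval I /\
  (forall s, I s -> 0 <= x s) /\
  (forall s, I s -> Derive x s ^ 2 + Derive t s ^ 2 = 1) /\
  (forall s, I s -> C2_near x s /\ C2_near t s) /\
  (forall s, I s -> 0 < x s -> Cinf_near x s /\ Cinf_near t s) /\
  (exists s, I s /\ 0 < x s).

Definition rot_surface (x t : R -> R) (s th : R) : H1 :=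
  (x s * cos th, x s * sin th, t s).

Definition rot_p_minimal (I : R -> Prop) (x t : R -> R) : Prop :=
  p_minimal (fun s _ => I s) (rot_surface x t).

(* The horizontal generating curve with angle function vth, rotated by phi. *)
Definition hgen_curve (x t vth : R -> R) (phi s : R) : H1 :=
  rot_surface x t s (vth s + phi).

Definition horizontal_angle (I : R -> Prop) (x t vth : R -> R) : Prop :=
  forall s, I s -> ex_derive vth s /\ in_xi (velocity (hgen_curve x t vth 0) s).

Definition horizontal_arclength (I : R -> Prop) (x t vth st : R -> R) : Prop :=
  horizontal_angle I x t vth /\
  forall s, I s ->
    is_derive st s (adapted_norm (velocity (hgen_curve x t vth 0) s)).

Definition energy (x t : R -> R) (s : R) : R :=
  x s * Derive t s / sqrt (x s ^ 2 * Derive x s ^ 2 + Derive t s ^ 2).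

(* x^2 = st^2 + c2 and t = m st up to an additive constant, for the horizontal
   arc-length parameter st. *)
Definition quadric_curve (I : R -> Prop) (x t vth st : R -> R) (c2 m : R)
  : Prop :=
  horizontal_arclength I x t vth st /\ m <> 0 /\
  exists k : R, forall s, I s ->
    x s ^ 2 = st s ^ 2 + c2 /\ t s = m * st s + k.

(* Y(V) lies in the surface generated by (x, t), and the field d/ds of the
   coordinates Y is the field e_1 = d/dst, tangent to the rotated horizontal
   generating curves. *)
Definition patch_of_rot (I : R -> Prop) (x t vth st : R -> R)
    (V : R * R -> Prop) (Y : R -> R -> H1) : Prop :=
  forall u v, V (u, v) ->
  exists s phi : R, I s /\
    Y u v = hgen_curve x t vth phi s /\
    scal (Derive st s) (d_fst Y u v) = velocity (hgen_curve x t vth phi) s.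

(* Main.v *)
Require Import Defs.
From Stdlib Require Import Reals Ranalysis5 Lra Psatz Classical.
From Coquelicot Require Import Coquelicot.

Open Scope R_scope.

(** For a surface of revolution, the vector W of polar components (x x', -t')
    spans the tangent plane intersected with xi, so e_1 = W / |W| and
    |W|^2 = x^2 x'^2 + t'^2.  The condition nabla_(e_1) J e_1 = 0 says that W
    stays parallel to itself along e_1, that is, W wedge D W = 0 for
    D = x^2 d/ds - t' d/dtheta, and this wedge product is, up to sign, the
    polynomial h = x^3 (x' t'' - x'' t') + t'^3 [pmc_numerator].  Hence
    p-minimality off the axis is the equation h = 0 [rot_p_minimalP].

    Two functions integrate this equation.  The energy E = x t' / |W| has
    derivative x' h / |W|^3, and x^2 x' / |W| has the derivative |W| / x of the
    horizontal arc length, up to the term t' h / (x |W|^3).  So h = 0 makes E a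
    constant m and st = x^2 x' / |W| a horizontal arc-length parameter, and the
    identity x^2 - (x^2 x' / |W|)^2 = E^2 is the quadric x^2 = st^2 + m^2;
    moreover t' = m st'.  Conversely, on a quadric curve both functions have the
    derivatives that h = 0 would give, so x' h = t' h = 0 and h = 0.  In passing,
    c2 must be m^2 [quadric_facts], so a quadric curve never meets the axis.
    The alternative of the theorem comes from |E| <= x: a nonzero energy keeps
    the curve away from the axis and propagates along the whole interval
    [energy_propagates], while energy zero off the axis forces t' = 0
    [t_const_of_zero_energy].

    The surface generated by a quadric curve is ruled by the horizontal lines
    that are tangent to e_1.  With sg = u + m v, the explicit parametrization
    (m cos v + sg sin v, m sin v - sg cos v, m sg + k) is a normal coordinate
    system with zeta1 = m v and zeta2 = m^2 [ruled_normal_coordinates], and it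
    reaches every point of the surface [ruled_through].  For uniqueness, in
    arbitrary normal coordinates Y the function sg = (pz Y - k) / m is the arc-length parameter.  Tangency to the surface
    gives alpha = sg / (sg^2 + m^2).  Comparing with the normal form of alpha on
    a segment v = const, where sg and u + zeta1 are both u plus a constant,
    identifies u + zeta1 with sg and zeta2 with m^2.  The normal form of b then
    gives d sg / dv = m, so zeta1 - m v has zero derivative on the connected
    domain [normal_invariants]. *)

(** * Propagation along intervals and over connected open sets *)

Lemma interval_conv (I : R -> Prop) (a b c : R) :
  interval I -> I a -> I b -> Rmin a b <= c <= Rmax a b -> I c.
Proof.
intros [HI _] Ha Hb Hc.
destruct (Rle_dec a b) as [Hab|Hab].
- rewrite Rmin_left, Rmax_right in Hc by lra. now apply (HI a b).
- rewrite Rmin_right, Rmax_left in Hc by lra. now apply (HI b a).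
Qed.

(** The functions at hand are related on [I] only, and [I] may contain its end
    points: there a two-sided derivative is determined by difference quotients
    taken inside [I]. *)
Lemma derive_unique_within (I : R -> Prop) (f g : R -> R) (s l l' : R) :
  interval I -> I s -> (forall r, I r -> f r = g r) ->
  is_derive f s l -> is_derive g s l' -> l = l'.
Proof.
intros HI Hs Hfg Hf Hg.
assert (Hd : is_derive (fun r => f r - g r) s (l - l')) by
  (apply (is_derive_minus f g s l l' Hf Hg)).
apply is_derive_Reals in Hd.
apply NNPP; intros Hne.
destruct (Hd (Rabs (l - l'))) as [d Hd']; [apply Rabs_pos_lt; lra|].
assert (Hb : exists b, I b /\ b <> s).
{ destruct HI as [_ (a & b & Ha & Hb & Hab)].
  destruct (Req_dec a s) as [E|E]; [exists b | exists a]; split; auto; lra. }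
destruct Hb as (b & Hb & Hbs).
assert (Hdp := cond_pos d).
set (q := Rmin 1 (d / (2 * Rabs (b - s)))).
assert (Hbp : 0 < Rabs (b - s)) by (apply Rabs_pos_lt; lra).
assert (Hq : 0 < q).
{ apply Rmin_pos; [lra|]. apply Rdiv_lt_0_compat; lra. }
assert (Hq1 : q <= 1) by apply Rmin_l.
assert (Hqd : q * Rabs (b - s) < d).
{ apply Rle_lt_trans with (d / (2 * Rabs (b - s)) * Rabs (b - s)).
  - apply Rmult_le_compat_r; [lra | apply Rmin_r].
  - field_simplify; lra. }
specialize (Hd' (q * (b - s))).
assert (Hr : I (s + q * (b - s))).
{ apply (interval_conv I s b); auto. unfold Rmin, Rmax.
  destruct (Rle_dec s b); nra. }
rewrite (Hfg _ Hr), (Hfg _ Hs) in Hd'.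
assert (H0 : q * (b - s) <> 0) by (apply Rmult_integral_contrapositive; lra).
specialize (Hd' H0).
rewrite Rabs_mult, (Rabs_pos_eq q) in Hd' by lra.
specialize (Hd' Hqd).
replace ((g (s + q * (b - s)) - g (s + q * (b - s)) - (g s - g s)) / (q * (b - s))
  - (l - l')) with (- (l - l')) in Hd' by (field; lra).
rewrite Rabs_Ropp in Hd'. lra.
Qed.

Lemma derive0_within_const (I : R -> Prop) (f : R -> R) (a b : R) :
  (forall p q r, I p -> I q -> p <= r <= q -> I r) ->
  (forall s, I s -> is_derive f s 0) -> I a -> I b -> f a = f b.
Proof.
intros HI Hf.
assert (H : forall a b, I a -> I b -> a < b -> f a = f b).
{ intros p q Hp Hq Hpq. apply (eq_is_derive f p q); [|exact Hpq].
  intros r Hr. apply Hf. apply (HI p q); auto. }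
intros Ha Hb. destruct (Rtotal_order a b) as [h|[h|h]].
- now apply H.
- now rewrite h.
- symmetry; now apply H.
Qed.

Definition locally_constant_on (I P : R -> Prop) : Prop :=
  forall s, I s -> locally s (fun r => I r -> (P r <-> P s)).

(** The supremum of the points up to which [P] holds throughout lies in [P] by
    local constancy, which then also carries [P] beyond it, unless it is [b]. *)
Lemma interval_clopen_right (I P : R -> Prop) (a b : R) :
  interval I -> locally_constant_on I P ->
  I a -> P a -> I b -> a <= b -> P b.
Proof.
intros HI HP Ha Pa Hb Hab.
set (S := fun r => a <= r <= b /\ forall q, a <= q <= r -> P q).
assert (Sa : S a).
{ split; [lra|]. intros q Hq. now replace q with a by lra. }
destruct (completeness S) as [c [Hub Hlub]].
{ exists b. intros r [Hr _]. lra. }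
{ now exists a. }
assert (Hac : a <= c) by now apply Hub.
assert (Hcb : c <= b) by (apply Hlub; intros r [Hr _]; lra).
assert (Hc : I c) by (apply (proj1 HI a b); auto).
destruct (HP c Hc) as [d Hd]. assert (Hdp := cond_pos d).
assert (Hd' : forall r, Rabs (r - c) < d -> I r -> (P r <-> P c)) by exact Hd.
assert (Hr : exists r, S r /\ c - d < r).
{ apply NNPP; intros Hn. assert (c <= c - d); [|lra].
  apply Hlub. intros r Sr. destruct (Rle_dec r (c - d)); [auto|].
  exfalso; apply Hn. exists r; split; auto; lra. }
destruct Hr as (r & Sr & Hrc).
assert (Hrc' : r <= c) by now apply Hub.
assert (Pc : P c).
{ apply (Hd' r).
  - apply Rabs_def1; lra.
  - apply (proj1 HI a b); auto. destruct Sr; lra.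
  - apply Sr. destruct Sr; lra. }
assert (Sn : S (Rmin b (c + d / 2))).
{ split.
  - split; [apply Rmin_glb; lra | apply Rmin_l].
  - intros q [Hq1 Hq2]. assert (q <= b) by (eapply Rle_trans; [exact Hq2|apply Rmin_l]).
    assert (q <= c + d/2) by (eapply Rle_trans; [exact Hq2|apply Rmin_r]).
    destruct (Rle_dec q r) as [h|h].
    + apply Sr; lra.
    + apply Hd'; auto. apply Rabs_def1; lra. apply (proj1 HI a b); auto. }
assert (Hle := Hub _ Sn).
replace b with (Rmin b (c + d / 2)) at 1.
- apply Sn. split; [|lra]. apply Rmin_glb; lra.
- apply Rmin_left. unfold Rmin in Hle. destruct (Rle_dec b (c + d / 2)); lra.
Qed.

(** Leftwards, the complement of [P] is propagated to the right instead. *)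
Lemma interval_clopen (I P : R -> Prop) (a b : R) :
  interval I -> locally_constant_on I P -> I a -> P a -> I b -> P b.
Proof.
intros HI HP Ha Pa Hb.
destruct (Rle_dec a b) as [Hab|Hab].
- now apply (interval_clopen_right I P a b).
- apply NNPP; intros Pb.
  apply (interval_clopen_right I (fun r => ~ P r) b a); auto; try lra.
  intros s Hs. generalize (HP s Hs). apply filter_imp. intros r Hr Ir.
  specialize (Hr Ir). tauto.
Qed.

Lemma locally_of_box (u v : R) (d : posreal) (P : R * R -> Prop) :
  (forall u' v', Rabs (u' - u) < d -> Rabs (v' - v) < d -> P (u', v')) ->
  locally (u, v) P.
Proof.
intros H. exists d. intros [u' v'] [H1' H2']. now apply H.
Qed.

Lemma box_of_open (V : R * R -> Prop) (u v : R) :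
  open V -> V (u, v) ->
  exists d : posreal, forall u' v', Rabs (u' - u) < d -> Rabs (v' - v) < d -> V (u', v').
Proof.
intros HV Huv. destruct (HV _ Huv) as [d Hd]. exists d.
intros u' v' Hu Hv. apply Hd. now split.
Qed.

Lemma derive0_segment (f : R -> R) (a b d : R) :
  (forall r, Rabs (r - a) < d -> is_derive f r 0) -> Rabs (b - a) < d -> f b = f a.
Proof.
intros Hf Hb.
assert (Hd : 0 < d) by (generalize (Rabs_pos (b - a)); lra).
apply (derive0_within_const (fun r => Rabs (r - a) < d)); auto.
- intros p q c Hp Hq Hc. apply Rabs_def2 in Hp; apply Rabs_def2 in Hq.
  apply Rabs_def1; lra.
- rewrite Rminus_diag, Rabs_R0; exact Hd.
Qed.

(** A function with zero partial derivatives is constant on small boxes, so that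
    its level set and the complement of that level set are both open. *)
Lemma partials0_const (V : R * R -> Prop) (F : R -> R -> R) :
  open V -> connected_set V ->
  (forall u v, V (u, v) ->
     is_derive (fun r => F r v) u 0 /\ is_derive (fun r => F u r) v 0) ->
  exists c, forall u v, V (u, v) -> F u v = c.
Proof.
intros HV HC HF.
assert (Hloc : forall u v, V (u, v) ->
  locally (u, v) (fun p => V p /\ F (fst p) (snd p) = F u v)).
{ intros u v Huv. destruct (box_of_open V u v HV Huv) as [d Hd].
  apply (locally_of_box u v d). intros u' v' Hu Hv. split; [auto|]. simpl.
  transitivity (F u' v).
  - apply (derive0_segment (fun r => F u' r) v v' d); [|exact Hv].
    intros r Hr. exact (proj2 (HF u' r (Hd u' r Hu Hr))).
  - apply (derive0_segment (fun r => F r v) u u' d); [|exact Hu].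
    intros r Hr. refine (proj1 (HF r v (Hd r v Hr _))).
    rewrite Rminus_diag, Rabs_R0; apply cond_pos. }
destruct (classic (exists u v, V (u, v))) as [(u0 & v0 & H0)|Hn].
2: { exists 0. intros u v Huv. exfalso; apply Hn; now exists u, v. }
exists (F u0 v0). intros u v Huv. apply NNPP; intros Hne.
destruct (HC (fun p => V p /\ F (fst p) (snd p) = F u0 v0)
             (fun p => V p /\ F (fst p) (snd p) <> F u0 v0))
  as (p & _ & [_ H1'] & [_ H2']).
- intros [u' v'] [Hp E]. generalize (Hloc u' v' Hp). apply filter_imp.
  intros q [Hq Eq]. split; [exact Hq|]. exact (eq_trans Eq E).
- intros [u' v'] [Hp E]. generalize (Hloc u' v' Hp). apply filter_imp.
  intros q [Hq Eq]. split; [exact Hq|]. intros E2; apply E; exact (eq_trans (eq_sym Eq) E2).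
- intros p Hp. destruct (classic (F (fst p) (snd p) = F u0 v0)); [left|right]; now split.
- exists (u0, v0). repeat split; auto.
- exists (u, v). repeat split; auto.
- now apply H2'.
Qed.
(** * Differentiability of functions of two variables with separated terms *)

(** [auto_derive] leaves eta-expanded functions under [Derive], which [ring] does
    not identify with the functions themselves. *)
Ltac eta_derive :=
  repeat match goal with
  | |- context [Derive (fun r => ?f r) ?u] =>
      progress change (Derive (fun r => f r) u) with (Derive f u)
  end.
Ltac eta_ring := eta_derive; ring.

Definition C1_at (f : R -> R) (u : R) : Prop :=
  locally u (fun r => ex_derive f r) /\ continuous (Derive f) u.

Lemma continuity_2d_fst (f : R -> R) (u v : R) :
  continuous f u -> continuity_2d_pt (fun u' _ => f u') u v.
Proof.
intros H. apply (continuity_1d_2d_pt_comp f (fun u' _ => u')).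
- now apply continuity_pt_filterlim.
- apply continuity_2d_pt_id1.
Qed.

Lemma continuity_2d_snd (f : R -> R) (u v : R) :
  continuous f v -> continuity_2d_pt (fun _ v' => f v') u v.
Proof.
intros H. apply (continuity_1d_2d_pt_comp f (fun _ v' => v')).
- now apply continuity_pt_filterlim.
- apply continuity_2d_pt_id2.
Qed.

Lemma continuity_2d_sum2 (f k g l : R -> R) (u v : R) :
  continuous f u -> continuous k v -> continuous g u -> continuous l v ->
  continuity_2d_pt (fun u' v' => f u' * k v' + g u' * l v') u v.
Proof.
intros Hf Hk Hg Hl.
apply continuity_2d_pt_plus; apply continuity_2d_pt_mult;
  now (apply continuity_2d_fst || apply continuity_2d_snd).
Qed.

Lemma ex_diff_1_sum2 (f k g l : R -> R) (u v : R) :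
  C1_at f u -> C1_at k v -> C1_at g u -> C1_at l v ->
  ex_diff_n (fun u' v' => f u' * k v' + g u' * l v') 1 u v.
Proof.
intros [Hf Hf'] [Hk Hk'] [Hg Hg'] [Hl Hl'].
assert (Hcf := locally_singleton _ _ Hf). assert (Hcg := locally_singleton _ _ Hg).
assert (Hck := locally_singleton _ _ Hk). assert (Hcl := locally_singleton _ _ Hl).
simpl in Hcf, Hcg, Hck, Hcl.
assert (Cf := ex_derive_continuous _ _ Hcf). assert (Cg := ex_derive_continuous _ _ Hcg).
assert (Ck := ex_derive_continuous _ _ Hck). assert (Cl := ex_derive_continuous _ _ Hcl).
simpl. repeat split.
- now apply continuity_2d_sum2.
- auto_derive; auto.
- auto_derive; auto.
- apply continuity_2d_pt_ext_loc with (fun u' v' => Derive f u' * k v' + Derive g u' * l v').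
  + destruct (filter_and _ _ Hf Hg) as [d Hd]. exists d. intros u' v' Hu' Hv'.
    destruct (Hd u' Hu'). symmetry. apply is_derive_unique. auto_derive; auto. eta_ring.
  + now apply continuity_2d_sum2.
- apply continuity_2d_pt_ext_loc with (fun u' v' => f u' * Derive k v' + g u' * Derive l v').
  + destruct (filter_and _ _ Hk Hl) as [d Hd]. exists d. intros u' v' Hu' Hv'.
    destruct (Hd v' Hv'). symmetry. apply is_derive_unique. auto_derive; auto. eta_ring.
  + now apply continuity_2d_sum2.
Qed.

Lemma C1_at_is_derive (f f' : R -> R) (u : R) :
  locally u (fun r => is_derive f r (f' r)) -> continuous f' u -> C1_at f u.
Proof.
intros H Hc. split.
- generalize H. apply filter_imp. intros r Hr. now exists (f' r).
- apply (continuous_ext_loc _ f'); auto.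
  generalize H. apply filter_imp. intros r Hr. symmetry. now apply is_derive_unique.
Qed.

Lemma C1_at_cos (u : R) : C1_at cos u.
Proof.
apply (C1_at_is_derive cos (fun r => - sin r)).
- apply filter_forall. intros r. auto_derive; auto. eta_ring.
- apply (ex_derive_continuous (fun r => - sin r)). now auto_derive.
Qed.

Lemma C1_at_sin (u : R) : C1_at sin u.
Proof.
apply (C1_at_is_derive sin cos).
- apply filter_forall. intros r. auto_derive; auto. eta_ring.
- apply (ex_derive_continuous cos). now auto_derive.
Qed.

Lemma C1_at_opp (f : R -> R) (u : R) : C1_at f u -> C1_at (fun r => - f r) u.
Proof.
intros [Hf Hf']. apply (C1_at_is_derive _ (fun r => - Derive f r)).
- generalize Hf. apply filter_imp. intros r Hr. auto_derive; auto. eta_ring.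
- now apply (continuous_opp (Derive f)).
Qed.

(** * The frame of a surface of revolution *)

Lemma param_vectorE (X : R -> R -> H1) (u v a b : R) :
  param_vector X u v a b =
  (a * px (d_fst X u v) + b * px (d_snd X u v),
   a * py (d_fst X u v) + b * py (d_snd X u v),
   a * pz (d_fst X u v) + b * pz (d_snd X u v)).
Proof. reflexivity. Qed.

Lemma velocity_is_derive (c : R -> H1) (s a b d : R) :
  is_derive (fun r => px (c r)) s a -> is_derive (fun r => py (c r)) s b ->
  is_derive (fun r => pz (c r)) s d ->
  velocity c s = (a, b, d + px (c s) * b - py (c s) * a).
Proof.
intros Ha Hb Hd. apply is_derive_unique in Ha, Hb, Hd.
transitivity (frame_coords (c s) (a, b, d)); [|reflexivity].
unfold velocity. apply f_equal. now apply (f_equal2 pair); [apply (f_equal2 pair)|].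
Qed.

Lemma H1_eq (a b c a' b' c' : R) : a = a' -> b = b' -> c = c' -> (a, b, c) = (a', b', c').
Proof. now intros -> -> ->. Qed.

Lemma sin2_cos2_pow (th : R) : cos th ^ 2 + sin th ^ 2 = 1.
Proof. generalize (sin2_cos2 th). unfold Rsqr. intros. lra. Qed.

Lemma d_fst_rot (x t : R -> R) (s th : R) :
  ex_derive x s -> ex_derive t s ->
  d_fst (rot_surface x t) s th = (Derive x s * cos th, Derive x s * sin th, Derive t s).
Proof.
intros Hx Ht. unfold d_fst.
rewrite (velocity_is_derive _ s (Derive x s * cos th) (Derive x s * sin th) (Derive t s)).
- apply H1_eq; auto. unfold rot_surface, px, py; simpl. ring.
- unfold rot_surface, px; simpl. auto_derive; auto; eta_ring.
- unfold rot_surface, py; simpl. auto_derive; auto; eta_ring.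
- unfold rot_surface, pz; simpl. now apply Derive_correct.
Qed.

Lemma d_snd_rot (x t : R -> R) (s th : R) :
  d_snd (rot_surface x t) s th = (- x s * sin th, x s * cos th, x s ^ 2).
Proof.
unfold d_snd.
rewrite (velocity_is_derive _ th (- x s * sin th) (x s * cos th) 0).
- apply H1_eq; auto. unfold rot_surface, px, py; simpl.
  assert (H := sin2_cos2_pow th).
  transitivity (x s ^ 2 * (cos th ^ 2 + sin th ^ 2)); [ring | rewrite H; ring].
- unfold rot_surface, px; simpl. auto_derive; auto; eta_ring.
- unfold rot_surface, py; simpl. auto_derive; auto; eta_ring.
- unfold rot_surface, pz; simpl. auto_derive; auto; eta_ring.
Qed.

Definition smooth_near (f : R -> R) (s : R) : Prop :=
  locally s (fun r =>
    ex_derive f r /\ ex_derive (Derive f) r /\ ex_derive (Derive (Derive f)) r).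

Lemma Cinf_smooth_near (f : R -> R) (s : R) : Cinf_near f s -> smooth_near f s.
Proof.
unfold Cinf_near, smooth_near. apply filter_imp. intros r H. split; [|split].
- exact (H 1%nat).
- exact (H 2%nat).
- exact (H 3%nat).
Qed.

(** The square of the adapted length of the velocity of the horizontal generating
    curve, multiplied by [x ^ 2]; it is the square of the denominator of the
    energy. *)
Definition speed2 (x t : R -> R) (s : R) : R := x s ^ 2 * Derive x s ^ 2 + Derive t s ^ 2.

(** The p-mean curvature up to its sign and a positive factor, off the axis. *)
Definition pmc_numerator (x t : R -> R) (s : R) : R :=
  x s ^ 3 * (Derive x s * Derive (Derive t) s - Derive (Derive x) s * Derive t s)
  + Derive t s ^ 3.

(** Off the axis the tangent plane contains the rotation field, whose component
    along [Tvec] is [x ^ 2]; hence it is never [xi]. *)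
Lemma regular_rot (x t : R -> R) (s th : R) :
  ex_derive x s -> ex_derive t s -> Derive x s ^ 2 + Derive t s ^ 2 = 1 ->
  (regular (rot_surface x t) s th <-> x s <> 0).
Proof.
intros Hx Ht Hu. assert (Hcs := sin2_cos2_pow th). split.
- intros [Him _] Hx0. destruct (Him 0 1) as [_ H]; [|lra].
  rewrite param_vectorE, d_fst_rot, d_snd_rot, Hx0 by auto.
  transitivity ((0, 0, 0) : H1); [|reflexivity].
  apply H1_eq; unfold px, py, pz; simpl; ring.
- intros Hx0. split.
  + intros a b. rewrite param_vectorE, d_fst_rot, d_snd_rot by auto.
    unfold px, py, pz; simpl. intros H.
    injection H as E1 E2 E3.
    change (@eq R (a * (Derive x s * cos th) + b * (- x s * sin th)) 0) in E1.
    change (@eq R (a * (Derive x s * sin th) + b * (x s * cos th)) 0) in E2.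
    change (@eq R (a * Derive t s + b * x s ^ 2) 0) in E3.
    set (p := Derive x s) in *. set (q := Derive t s) in *.
    set (c := cos th) in *. set (n := sin th) in *. set (X := x s) in *.
    assert (Hb : b * X = 0).
    { transitivity (b * X * (c ^ 2 + n ^ 2)); [rewrite Hcs; ring|].
      transitivity (c * (a * (p * n) + b * (X * c)) - n * (a * (p * c) + b * (- X * n)));
      [ring | rewrite E1, E2; ring]. }
    assert (b = 0) by (apply Rmult_integral in Hb; tauto). subst b. split; auto.
    assert (Hp : a * p = 0).
    { transitivity (a * p * (c ^ 2 + n ^ 2)); [rewrite Hcs; ring|].
      transitivity (c * (a * (p * c) + 0 * (- X * n)) + n * (a * (p * n) + 0 * (X * c)));
      [ring | rewrite E1, E2; ring]. }
    assert (Hq : a * q = 0) by (simpl in E3; lra).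
    replace a with (a * (p ^ 2 + q ^ 2)) by (rewrite Hu; ring).
    replace (a * (p ^ 2 + q ^ 2)) with ((a * p) * p + (a * q) * q) by ring.
    rewrite Hp, Hq. ring.
  + intros H. destruct (H (param_vector (rot_surface x t) s th 0 1)) as [H' _].
    assert (H2 : in_xi (param_vector (rot_surface x t) s th 0 1)).
    { apply H'. now exists 0, 1. }
    rewrite param_vectorE, d_fst_rot, d_snd_rot in H2 by auto.
    unfold in_xi, pz in H2; simpl in H2. nra.
Qed.
(** * The p-mean curvature of a surface of revolution *)

Lemma locally_2d_fst (P : R -> Prop) (u v : R) :
  locally u P -> locally_2d (fun u' _ => P u') u v.
Proof. intros [d Hd]. exists d. intros u' v' Hu' _. now apply Hd. Qed.

Lemma nablaE (W : R -> R -> H1) (u v a b : R) :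
  nabla W u v a b =
  (a * Derive (fun r => px (W r v)) u + b * Derive (fun r => px (W u r)) v,
   a * Derive (fun r => py (W r v)) u + b * Derive (fun r => py (W u r)) v,
   a * Derive (fun r => pz (W r v)) u + b * Derive (fun r => pz (W u r)) v).
Proof. reflexivity. Qed.

Lemma Derive_cross (f g k l : R -> R) (s : R) :
  ex_derive f s -> ex_derive g s -> ex_derive k s -> ex_derive l s ->
  Derive (fun r => f r * g r - k r * l r) s =
  Derive f s * g s + f s * Derive g s - (Derive k s * l s + k s * Derive l s).
Proof.
intros. rewrite Derive_minus, !Derive_mult; auto; now apply ex_derive_mult.
Qed.

(** The field [e] is only known to be one of the two unit vectors of a line.
    Instead of choosing a sign, the relation saying that [e] is parallel to the
    unnormalized field [(W1, W2)] is differentiated along [e] itself: as the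
    covariant derivative of [e] vanishes, only the derivative of [(W1, W2)]
    remains. *)
Lemma pmc_numerator_0_of_p_minimal_at (x t : R -> R) (s th : R) (e : R -> R -> H1) :
  x s <> 0 -> smooth_near x s -> smooth_near t s ->
  char_field (rot_surface x t) e s th ->
  p_mean_curvature (rot_surface x t) e s th 0 ->
  pmc_numerator x t s = 0.
Proof.
intros Hx0 Sx St Hchar (a & b & He & HH).
(* (W1, W2) spans the tangent plane intersected with xi *)
set (W1 := fun r v => x r * Derive x r * cos v + Derive t r * sin v).
set (W2 := fun r v => x r * Derive x r * sin v - Derive t r * cos v).
assert (Hpar : locally_2d (fun r v => px (e r v) * W2 r v - py (e r v) * W1 r v = 0) s th).
{ assert (Hl := locally_2d_fst _ s th (filter_and _ _ Sx St)).
  generalize (locally_2d_and _ _ _ _ Hchar Hl). apply locally_2d_impl.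
  apply locally_2d_forall.
  intros r v [((a' & b' & He') & Hxi & _) [[Hx _] [Ht _]]].
  rewrite param_vectorE, d_fst_rot, d_snd_rot in He' by auto.
  unfold in_xi in Hxi. rewrite He' in Hxi |- *.
  unfold W1, W2, px, py, pz in *; simpl in *.
  assert (Hcs := sin2_cos2_pow v).
  transitivity (- Derive x r * (a' * Derive t r + b' * (x r * (x r * 1)))
     * (cos v ^ 2 + sin v ^ 2)); [ring | rewrite Hxi; ring]. }
destruct (locally_2d_singleton _ _ _ Hchar) as (_ & Hxi & Hn & Cx & Cy & _).
destruct (locally_singleton _ _ Sx) as (Dx & Dx1 & _).
destruct (locally_singleton _ _ St) as (Dt & Dt1 & _).
destruct Cx as (_ & Cxu & Cxv & _). destruct Cy as (_ & Cyu & Cyv & _).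
rewrite nablaE in HH.
set (pu := Derive (fun r => px (e r th)) s). set (pv := Derive (fun r => px (e s r)) th).
set (qu := Derive (fun r => py (e r th)) s). set (qv := Derive (fun r => py (e s r)) th).
assert (Hq : a * qu + b * qv = 0).
{ assert (E1 := f_equal px HH).
  change (a * Derive (fun r => - py (e r th)) s + b * Derive (fun r => - py (e s r)) th
    = - 0 * px (e s th)) in E1.
  rewrite !Derive_opp in E1. fold qu qv in E1. lra. }
assert (Hp : a * pu + b * pv = 0).
{ assert (E2 := f_equal py HH).
  change (a * pu + b * pv = - 0 * py (e s th)) in E2. lra. }
assert (Xu1 : ex_derive (fun r => W1 r th) s) by (unfold W1; auto_derive; auto).
assert (Xu2 : ex_derive (fun r => W2 r th) s) by (unfold W2; auto_derive; auto).
assert (Xv1 : ex_derive (fun r => W1 s r) th) by (unfold W1; auto_derive; auto).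
assert (Xv2 : ex_derive (fun r => W2 s r) th) by (unfold W2; auto_derive; auto).
assert (HDu : pu * W2 s th + px (e s th) * Derive (fun r => W2 r th) s
  - (qu * W1 s th + py (e s th) * Derive (fun r => W1 r th) s) = 0).
{ assert (H0 : Derive (fun r => px (e r th) * W2 r th - py (e r th) * W1 r th) s = 0).
  { rewrite (Derive_ext_loc _ (fun _ => 0)); [apply Derive_const|].
    exact (locally_2d_1d_const_y _ _ _ Hpar). }
  rewrite <- H0. symmetry.
  exact (Derive_cross _ _ _ _ _ Cxu Xu2 Cyu Xu1). }
assert (HDv : pv * W2 s th + px (e s th) * Derive (fun r => W2 s r) th
  - (qv * W1 s th + py (e s th) * Derive (fun r => W1 s r) th) = 0).
{ assert (H0 : Derive (fun r => px (e s r) * W2 s r - py (e s r) * W1 s r) th = 0).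
  { rewrite (Derive_ext_loc _ (fun _ => 0)); [apply Derive_const|].
    exact (locally_2d_1d_const_x _ _ _ Hpar). }
  rewrite <- H0. symmetry.
  exact (Derive_cross _ _ _ _ _ Cxv Xv2 Cyv Xv1). }
set (x0 := x s) in *. set (x1 := Derive x s) in *. set (x2 := Derive (Derive x) s) in *.
set (t1 := Derive t s) in *. set (t2 := Derive (Derive t) s) in *.
assert (F1 : Derive (fun r => W1 r th) s = (x1 ^ 2 + x0 * x2) * cos th + t2 * sin th).
{ apply is_derive_unique. unfold W1. auto_derive; auto. unfold x0, x1, x2, t2. eta_ring. }
assert (F2 : Derive (fun r => W2 r th) s = (x1 ^ 2 + x0 * x2) * sin th - t2 * cos th).
{ apply is_derive_unique. unfold W2. auto_derive; auto. unfold x0, x1, x2, t2. eta_ring. }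
assert (F3 : Derive (fun r => W1 s r) th = - x0 * x1 * sin th + t1 * cos th).
{ apply is_derive_unique. unfold W1. auto_derive; auto. unfold x0, x1, t1. eta_ring. }
assert (F4 : Derive (fun r => W2 s r) th = x0 * x1 * cos th + t1 * sin th).
{ apply is_derive_unique. unfold W2. auto_derive; auto. unfold x0, x1, t1. eta_ring. }
rewrite F1, F2 in HDu. rewrite F3, F4 in HDv.
rewrite param_vectorE, d_fst_rot, d_snd_rot in He by auto.
fold x0 x1 t1 in He.
unfold in_xi in Hxi. unfold adapted_norm in Hn. rewrite Hxi in Hn.
rewrite He in HDu, HDv, Hxi, Hn.
unfold px, py, pz in HDu, HDv, Hxi, Hn; simpl in HDu, HDv, Hxi, Hn.
assert (Hcs := sin2_cos2_pow th).
set (c := cos th) in *. set (n := sin th) in *.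
(* the same relation in polar components, where theta has disappeared *)
assert (Hcross : a * x1 * (- a * t2 + b * (x0 * x1))
   - b * x0 * (a * (x1 ^ 2 + x0 * x2) + b * t1) = 0).
{ transitivity ((a * x1 * (- a * t2 + b * (x0 * x1))
   - b * x0 * (a * (x1 ^ 2 + x0 * x2) + b * t1)) * (c ^ 2 + n ^ 2)
   + (a * pu + b * pv) * W2 s th - (a * qu + b * qv) * W1 s th).
  - rewrite Hcs, Hp, Hq. ring.
  - match type of HDu with ?A = 0 => match type of HDv with ?B = 0 =>
      transitivity (a * A + b * B); [ring | rewrite HDu, HDv; ring] end end. }
assert (Hb : b = - a * t1 / x0 ^ 2).
{ apply (Rmult_eq_reg_r (x0 ^ 2)); [|now apply pow_nonzero]. field_simplify; auto. lra. }
assert (Ha : a <> 0).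
{ intros Ha. rewrite Ha in Hb. rewrite Hb, Ha in Hn.
  replace (- 0 * t1 / x0 ^ 2) with 0 in Hn by (field; auto).
  match type of Hn with sqrt ?A = 1 => replace A with 0 in Hn by ring end.
  rewrite sqrt_0 in Hn. lra. }
rewrite Hb in Hcross.
apply (Rmult_eq_reg_l (- a ^ 2 / x0 ^ 3)).
2: { apply Rmult_integral_contrapositive_currified.
     - apply Ropp_neq_0_compat. now apply pow_nonzero.
     - apply Rinv_neq_0_compat. now apply pow_nonzero. }
rewrite Rmult_0_r, <- Hcross. unfold pmc_numerator. fold x0 x1 x2 t1 t2.
field. auto.
Qed.

Lemma speed2_pos (x t : R -> R) (s : R) :
  x s <> 0 -> Derive x s ^ 2 + Derive t s ^ 2 = 1 -> 0 < speed2 x t s.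
Proof.
intros Hx Hu. unfold speed2.
assert (0 < x s ^ 2) by nra. nra.
Qed.

Lemma is_derive_speed2 (x t : R -> R) (s : R) :
  ex_derive x s -> ex_derive (Derive x) s -> ex_derive (Derive t) s ->
  is_derive (speed2 x t) s
    (2 * (x s * Derive x s ^ 3 + x s ^ 2 * Derive x s * Derive (Derive x) s
      + Derive t s * Derive (Derive t) s)).
Proof. intros. unfold speed2. auto_derive; auto. eta_ring. Qed.

(** Rational form of the derivative of a quotient by [sqrt speed2], common to
    the energy, to the arc-length parameter and to the components of e_1. *)
Lemma is_derive_over_speed (x t f : R -> R) (s f' : R) :
  ex_derive x s -> ex_derive (Derive x) s -> ex_derive (Derive t) s ->
  0 < speed2 x t s -> is_derive f s f' ->
  is_derive (fun r => f r / sqrt (speed2 x t r)) s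
    ((f' * speed2 x t s
      - f s * (x s * Derive x s ^ 3 + x s ^ 2 * Derive x s * Derive (Derive x) s
      + Derive t s * Derive (Derive t) s)) / (speed2 x t s * sqrt (speed2 x t s))).
Proof.
intros Hx Hx1 Ht1 Hq Hf.
assert (Hs := sqrt_lt_R0 _ Hq).
assert (Hd := is_derive_speed2 x t s Hx Hx1 Ht1).
assert (Hsq := is_derive_sqrt _ _ _ Hd Hq).
evar_last. { apply (is_derive_div f); [exact Hf | exact Hsq | lra]. }
simpl.
assert (E : speed2 x t s = sqrt (speed2 x t s) ^ 2) by (rewrite <- Rsqr_pow2, Rsqr_sqrt; lra).
set (w := sqrt (speed2 x t s)) in *. rewrite !E. field. lra.
Qed.

(** The energy is a first integral of the equation [pmc_numerator = 0]. *)
Lemma is_derive_energy (x t : R -> R) (s : R) :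
  x s <> 0 -> Derive x s ^ 2 + Derive t s ^ 2 = 1 ->
  smooth_near x s -> smooth_near t s ->
  is_derive (energy x t) s
   (Derive x s * pmc_numerator x t s / (speed2 x t s * sqrt (speed2 x t s))).
Proof.
intros Hx0 Hu Sx St. assert (Hq := speed2_pos x t s Hx0 Hu).
destruct (locally_singleton _ _ Sx) as (Dx & Dx1 & _).
destruct (locally_singleton _ _ St) as (Dt & Dt1 & _).
evar_last.
{ apply (is_derive_over_speed x t (fun r => x r * Derive t r)); auto.
  auto_derive; [now split | reflexivity]. }
eta_derive. unfold pmc_numerator. f_equal. unfold speed2. ring.
Qed.

(** [x] times the radial component of e_1.  It turns out to be a horizontal
    arc-length parameter exactly when [Derive t s * pmc_numerator x t s] vanishes. *)
Definition radial_parameter (x t : R -> R) (s : R) : R :=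
  x s ^ 2 * Derive x s / sqrt (speed2 x t s).

Lemma is_derive_radial_parameter (x t : R -> R) (s : R) :
  x s <> 0 -> Derive x s ^ 2 + Derive t s ^ 2 = 1 ->
  smooth_near x s -> smooth_near t s ->
  is_derive (radial_parameter x t) s
   (sqrt (speed2 x t s) / x s
    - Derive t s * pmc_numerator x t s / (x s * (speed2 x t s * sqrt (speed2 x t s)))).
Proof.
intros Hx0 Hu Sx St. assert (Hq := speed2_pos x t s Hx0 Hu).
destruct (locally_singleton _ _ Sx) as (Dx & Dx1 & _).
destruct (locally_singleton _ _ St) as (Dt & Dt1 & _).
assert (Hs := sqrt_lt_R0 _ Hq).
evar_last.
{ apply (is_derive_over_speed x t (fun r => x r ^ 2 * Derive x r)); auto.
  auto_derive; [now split | reflexivity]. }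
eta_derive.
assert (E : sqrt (speed2 x t s) ^ 2 = speed2 x t s) by (rewrite <- Rsqr_pow2, Rsqr_sqrt; lra).
replace (sqrt (speed2 x t s) / x s) with
  (speed2 x t s ^ 2 / (x s * (speed2 x t s * sqrt (speed2 x t s)))).
2: { rewrite <- E at 1 2. field. split; lra. }
unfold pmc_numerator. field_simplify_eq; [|split; lra].
unfold speed2. ring.
Qed.

(** The horizontal unit tangent pointing in the direction of the generating
    curve. *)
Definition rot_e1 (x t : R -> R) (s th : R) : H1 :=
  ((x s * Derive x s * cos th + Derive t s * sin th) / sqrt (speed2 x t s),
   (x s * Derive x s * sin th - Derive t s * cos th) / sqrt (speed2 x t s), 0).

Lemma C1_at_over_speed (x t f : R -> R) (s : R) :
  smooth_near x s -> smooth_near t s -> 0 < speed2 x t s ->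
  locally s (fun r => ex_derive f r /\ ex_derive (Derive f) r) ->
  C1_at (fun r => f r / sqrt (speed2 x t r)) s.
Proof.
intros Sx St Hq Hf.
destruct (locally_singleton _ _ Sx) as (Dx & Dx1 & Dx2).
destruct (locally_singleton _ _ St) as (Dt & Dt1 & Dt2).
destruct (locally_singleton _ _ Hf) as (Df & Df1).
assert (Hd := is_derive_speed2 x t s Dx Dx1 Dt1).
assert (Hq' : locally s (fun r => 0 < speed2 x t r)).
{ apply (ex_derive_continuous (speed2 x t) s).
  - eexists; exact Hd.
  - now apply (open_gt 0). }
apply (C1_at_is_derive _ (fun r => (Derive f r * speed2 x t r
      - f r * (x r * Derive x r ^ 3 + x r ^ 2 * Derive x r * Derive (Derive x) r
      + Derive t r * Derive (Derive t) r)) / (speed2 x t r * sqrt (speed2 x t r)))).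
- generalize (filter_and _ _ Hq' (filter_and _ _ Hf (filter_and _ _ Sx St))).
  apply filter_imp. intros r (Hr & (Hf1 & _) & (Hx & Hx1 & _) & (Ht & Ht1 & _)).
  apply is_derive_over_speed; auto. now apply Derive_correct.
- apply (ex_derive_continuous (V := R_NormedModule)).
  assert (ex_derive (speed2 x t) s) by (eexists; exact Hd).
  assert (Hs := sqrt_lt_R0 _ Hq).
  auto_derive; repeat split; auto.
  apply Rmult_integral_contrapositive_currified; lra.
Qed.

(** The polar components of [rot_e1] depend on [s] only, and differentiating along
    e_1 turns their frame by the angle that [pmc_numerator = 0] compensates. *)
Lemma p_minimal_at_of_pmc_numerator_0 (x t : R -> R) (s th : R) :
  x s <> 0 -> Derive x s ^ 2 + Derive t s ^ 2 = 1 ->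
  smooth_near x s -> smooth_near t s -> pmc_numerator x t s = 0 ->
  char_field (rot_surface x t) (rot_e1 x t) s th /\
  p_mean_curvature (rot_surface x t) (rot_e1 x t) s th 0.
Proof.
intros Hx0 Hu Sx St Hh. assert (Hq := speed2_pos x t s Hx0 Hu).
assert (Hs := sqrt_lt_R0 _ Hq).
destruct (locally_singleton _ _ Sx) as (Dx & Dx1 & _).
destruct (locally_singleton _ _ St) as (Dt & Dt1 & _).
assert (Hcomb : forall r v, ex_derive x r -> ex_derive t r -> x r <> 0 -> 0 < speed2 x t r ->
  rot_e1 x t r v = param_vector (rot_surface x t) r v
    (x r / sqrt (speed2 x t r)) (- Derive t r / (x r * sqrt (speed2 x t r)))).
{ intros r v Hx Ht Hx' Hr. assert (Hsr := sqrt_lt_R0 _ Hr).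
  rewrite param_vectorE, d_fst_rot, d_snd_rot by auto.
  unfold rot_e1. apply H1_eq; unfold px, py, pz; simpl; field; lra. }
split.
- apply locally_2d_impl with (fun r _ => (0 < speed2 x t r /\ x r <> 0) /\
    smooth_near x r /\ smooth_near t r).
  2: { apply (locally_2d_fst (fun r => (0 < speed2 x t r /\ x r <> 0) /\
         smooth_near x r /\ smooth_near t r)).
       apply filter_and; [apply filter_and | apply filter_and; now apply locally_locally].
       - apply (ex_derive_continuous (speed2 x t) s).
         + eexists. now apply is_derive_speed2.
         + now apply (open_gt 0).
       - refine (ex_derive_continuous x s Dx (fun z => z <> 0) _). now apply (open_neq 0). }
  apply locally_2d_forall. intros r v [[Hr Hx'] [Sx' St']].
  assert (Hsr := sqrt_lt_R0 _ Hr).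
  destruct (locally_singleton _ _ Sx') as (Ex & Ex1 & _).
  destruct (locally_singleton _ _ St') as (Et & Et1 & _).
  split; [|split; [|split]].
  + eexists; eexists. apply Hcomb; auto.
  + reflexivity.
  + unfold adapted_norm, rot_e1, px, py, pz; simpl.
    match goal with |- sqrt ?A = 1 => replace A with 1; [apply sqrt_1|] end.
    assert (E : sqrt (speed2 x t r) ^ 2 = speed2 x t r)
      by (rewrite <- Rsqr_pow2, Rsqr_sqrt; lra).
    assert (Hcs := sin2_cos2_pow v).
    transitivity (speed2 x t r * (cos v ^ 2 + sin v ^ 2) / sqrt (speed2 x t r) ^ 2).
    * rewrite E, Hcs. field. lra.
    * unfold speed2 at 1. field. lra.
  + assert (Cf : C1_at (fun r => x r * Derive x r / sqrt (speed2 x t r)) r).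
    { apply C1_at_over_speed; auto. generalize Sx'. intros Sx2. apply locally_locally in Sx2.
      generalize Sx2. apply filter_imp. intros q Sq.
      destruct (locally_singleton _ _ Sq) as (Fx & Fx1 & Fx2). split; [now auto_derive|].
      apply (ex_derive_ext_loc (fun z => Derive x z * Derive x z + x z * Derive (Derive x) z)).
      - generalize Sq. apply filter_imp. intros z (Gx & Gx1 & _).
        symmetry. apply is_derive_unique. auto_derive; auto. eta_ring.
      - auto_derive; auto. }
    assert (Cg : C1_at (fun r => Derive t r / sqrt (speed2 x t r)) r).
    { apply C1_at_over_speed; auto. unfold smooth_near in St'. generalize St'. apply filter_imp. tauto. }
    split; [|split].
    * apply (ex_diff_n_ext_loc (fun u' v' => (x u' * Derive x u' / sqrt (speed2 x t u')) * cos v'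
         + (Derive t u' / sqrt (speed2 x t u')) * sin v')).
      { apply locally_2d_forall. intros u' v'. unfold px, rot_e1, Rdiv; simpl. ring. }
      apply ex_diff_1_sum2; auto using C1_at_cos, C1_at_sin.
    * apply (ex_diff_n_ext_loc (fun u' v' => (x u' * Derive x u' / sqrt (speed2 x t u')) * sin v'
         + (Derive t u' / sqrt (speed2 x t u')) * - cos v')).
      { apply locally_2d_forall. intros u' v'. unfold py, rot_e1, Rdiv; simpl. ring. }
      apply (ex_diff_1_sum2 _ _ _ (fun r => - cos r)); auto using C1_at_cos, C1_at_sin, C1_at_opp.
    * apply (ex_diff_n_ext_loc (fun u' v' => 0 * v' + 0 * v')).
      { apply locally_2d_forall. intros u' v'. unfold pz, rot_e1; simpl. ring. }
      assert (C1_at (fun r => r) v).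
      { apply (C1_at_is_derive _ (fun _ => 1)).
        - apply filter_forall. intros q. auto_derive; auto.
        - apply continuous_const. }
      assert (C1_at (fun _ => 0) r).
      { apply (C1_at_is_derive _ (fun _ => 0)).
        - apply filter_forall. intros q. auto_derive; auto.
        - apply continuous_const. }
      apply (ex_diff_1_sum2 (fun _ => 0) (fun r => r) (fun _ => 0) (fun r => r)); auto.
- eexists; eexists. split; [apply Hcomb; auto|].
  set (w := sqrt (speed2 x t s)) in *.
  (* the differences between the derivatives found and those claimed are
     multiples of the numerator of the p-mean curvature *)
  assert (D1 : is_derive (fun r => x r * Derive x r / sqrt (speed2 x t r)) s
    (Derive t s ^ 2 / (x s ^ 2 * w))).
  { evar_last.
    { apply (is_derive_over_speed x t (fun r => x r * Derive x r)); auto.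
      auto_derive; [now split | reflexivity]. }
    eta_derive. fold w. apply Rminus_diag_uniq.
    transitivity (- Derive t s * pmc_numerator x t s / (x s ^ 2 * (speed2 x t s * w))).
    - unfold pmc_numerator, speed2 in *. field. repeat split; lra.
    - rewrite Hh. field. repeat split; lra. }
  assert (D2 : is_derive (fun r => Derive t r / sqrt (speed2 x t r)) s
    (- Derive x s * Derive t s / (x s * w))).
  { evar_last.
    { apply (is_derive_over_speed x t (Derive t)); auto. now apply Derive_correct. }
    fold w. apply Rminus_diag_uniq.
    transitivity (Derive x s * pmc_numerator x t s / (x s * (speed2 x t s * w))).
    - unfold pmc_numerator, speed2 in *. field. repeat split; lra.
    - rewrite Hh. field. repeat split; lra. }
  rewrite nablaE.
  set (F := fun r => x r * Derive x r / sqrt (speed2 x t r)) in *.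
  set (G := fun r => Derive t r / sqrt (speed2 x t r)) in *.
  assert (Je : forall r v, J (rot_e1 x t r v) =
    (- (F r * sin v - G r * cos v), F r * cos v + G r * sin v, 0)).
  { intros r v. unfold J, rot_e1, F, G, px, py; simpl. apply H1_eq; unfold Rdiv; ring. }
  assert (XF : ex_derive F s) by (eexists; exact D1).
  assert (XG : ex_derive G s) by (eexists; exact D2).
  assert (E1 : forall v, Derive (fun r => px (J (rot_e1 x t r v))) s =
     - (Derive F s * sin v - Derive G s * cos v)).
  { intros v. rewrite (Derive_ext _ (fun r => - (F r * sin v - G r * cos v))).
    - apply is_derive_unique. auto_derive; auto. eta_ring.
    - intros r. now rewrite Je. }
  assert (E2 : forall v, Derive (fun r => py (J (rot_e1 x t r v))) s =
     Derive F s * cos v + Derive G s * sin v).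
  { intros v. rewrite (Derive_ext _ (fun r => F r * cos v + G r * sin v)).
    - apply is_derive_unique. auto_derive; auto. eta_ring.
    - intros r. now rewrite Je. }
  assert (E3 : Derive (fun v => px (J (rot_e1 x t s v))) th =
     - (F s * cos th + G s * sin th)).
  { rewrite (Derive_ext _ (fun v => - (F s * sin v - G s * cos v))).
    - apply is_derive_unique. auto_derive; auto. ring.
    - intros r. now rewrite Je. }
  assert (E4 : Derive (fun v => py (J (rot_e1 x t s v))) th =
     - F s * sin th + G s * cos th).
  { rewrite (Derive_ext _ (fun v => F s * cos v + G s * sin v)).
    - apply is_derive_unique. auto_derive; auto. ring.
    - intros r. now rewrite Je. }
  rewrite E1, E2, E3, E4.
  assert (D1' : Derive F s = _) by exact (is_derive_unique _ _ _ D1).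
  assert (D2' : Derive G s = _) by exact (is_derive_unique _ _ _ D2).
  rewrite D1', D2'.
  transitivity ((0, 0, 0) : H1).
  + apply H1_eq.
    * unfold F, G. fold w. field. split; lra.
    * unfold F, G. fold w. field. split; lra.
    * unfold J, pz; simpl. rewrite !Derive_const. ring.
  + transitivity ((- 0 * px (rot_e1 x t s th), - 0 * py (rot_e1 x t s th),
                   - 0 * pz (rot_e1 x t s th)) : H1); [|reflexivity].
    apply H1_eq; ring.
Qed.
(** * Explicit normal coordinates on a ruled surface *)

Lemma unit_circle_angle (a b : R) : a ^ 2 + b ^ 2 = 1 -> exists w, cos w = a /\ sin w = b.
Proof.
intros H. assert (Ha : -1 <= a <= 1) by nra.
assert (Hs : sqrt (1 - a²) = Rabs b).
{ rewrite <- sqrt_Rsqr_abs. f_equal. unfold Rsqr. lra. }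
destruct (Rle_dec 0 b) as [Hb|Hb].
- exists (acos a). rewrite cos_acos, sin_acos, Hs by exact Ha. split; auto. now apply Rabs_pos_eq.
- exists (- acos a). rewrite cos_neg, sin_neg, cos_acos, sin_acos, Hs by exact Ha.
  split; auto. rewrite Rabs_left; lra.
Qed.

Lemma cos_sin_inj (v w : R) :
  Rabs (v - w) < 2 -> cos v = cos w -> sin v = sin w -> v = w.
Proof.
intros Hvw Hc Hs.
assert (H1 : cos (v - w) = 1).
{ rewrite cos_minus, Hc, Hs. generalize (sin2_cos2 w). unfold Rsqr. lra. }
assert (H2 : sin ((v - w) / 2) = 0).
{ assert (H := cos_2a_sin ((v - w) / 2)). replace (2 * ((v - w) / 2)) with (v - w) in H by field.
  rewrite H1 in H. nra. }
assert (HPI := PI2_1). apply Rabs_def2 in Hvw.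
destruct (Rtotal_order v w) as [h|[h|h]]; auto; exfalso.
- assert (0 < sin (- ((v - w) / 2))) by (apply sin_gt_0; lra). rewrite sin_neg in H. lra.
- assert (0 < sin ((v - w) / 2)) by (apply sin_gt_0; lra). lra.
Qed.

Definition box (u v d : R) (p : R * R) : Prop :=
  Rabs (fst p - u) < d /\ Rabs (snd p - v) < d.

Lemma box_is_open (u v d : R) : open (box u v d).
Proof.
intros [u' v'] [Hu Hv]. simpl in Hu, Hv.
assert (He : 0 < Rmin (d - Rabs (u' - u)) (d - Rabs (v' - v))) by (apply Rmin_pos; lra).
apply (locally_of_box u' v' (mkposreal _ He)). simpl. intros u2 v2 H1 H2.
apply Rlt_le_trans with (2 := Rmin_l _ _) in H1 as H1'.
apply Rlt_le_trans with (2 := Rmin_r _ _) in H2 as H2'.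
split; simpl.
- replace (u2 - u) with ((u2 - u') + (u' - u)) by ring.
  generalize (Rabs_triang (u2 - u') (u' - u)). lra.
- replace (v2 - v) with ((v2 - v') + (v' - v)) by ring.
  generalize (Rabs_triang (v2 - v') (v' - v)). lra.
Qed.

Lemma box_convex (u v d : R) (p q : R * R) (r : R) :
  box u v d p -> box u v d q -> 0 <= r <= 1 ->
  box u v d (fst p + r * (fst q - fst p), snd p + r * (snd q - snd p)).
Proof.
assert (H : forall a b c, Rabs (a - c) < d -> Rabs (b - c) < d -> 0 <= r <= 1 ->
  Rabs (a + r * (b - a) - c) < d).
{ intros a b c Ha Hb Hr. apply Rabs_def2 in Ha; apply Rabs_def2 in Hb.
  replace (a + r * (b - a) - c) with ((1 - r) * (a - c) + r * (b - c)) by ring.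
  (* the smaller of the two gaps to d survives in the convex combination *)
  assert (Hm : 0 < Rmin (d - (a - c)) (d - (b - c))) by (apply Rmin_pos; lra).
  assert (Hn : 0 < Rmin (d + (a - c)) (d + (b - c))) by (apply Rmin_pos; lra).
  assert (M1 := Rmin_l (d - (a - c)) (d - (b - c))). assert (M2 := Rmin_r (d - (a - c)) (d - (b - c))).
  assert (N1 := Rmin_l (d + (a - c)) (d + (b - c))). assert (N2 := Rmin_r (d + (a - c)) (d + (b - c))).
  apply Rabs_def1; nra. }
intros [P1 P2] [Q1 Q2] Hr. split; now apply H.
Qed.

(** Along a segment from a point of [A] to a point of [B] membership in [A] would
    be locally constant if [A] and [B] did not meet in [V]. *)
Lemma convex_connected (V : R * R -> Prop) :
  (forall p q r, V p -> V q -> 0 <= r <= 1 ->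
     V (fst p + r * (fst q - fst p), snd p + r * (snd q - snd p))) ->
  connected_set V.
Proof.
intros HV A B HA HB Hcov [p [Vp Ap]] [q [Vq Bq]].
apply NNPP; intros Hn.
set (g := fun r : R => (fst p + r * (fst q - fst p), snd p + r * (snd q - snd p))).
assert (Hg : forall (U : R * R -> Prop) r, open U -> U (g r) -> locally r (fun z => U (g z))).
{ intros U r HU Hr. destruct (box_of_open U _ _ HU Hr) as [d Hd].
  assert (C : forall a b : R, locally r (fun z : R => Rabs (a + z * b - (a + r * b)) < d)).
  { intros a b.
    refine (ex_derive_continuous (fun z : R => a + z * b) r _ (fun y => Rabs (y - (a + r * b)) < d) _).
    - auto_derive; auto.
    - exists d. intros y Hy. exact Hy. }
  generalize (filter_and _ _ (C (fst p) (fst q - fst p)) (C (snd p) (snd q - snd p))).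
  apply filter_imp. intros z [H1 H2]. now apply Hd. }
assert (HA1 : A (g 1)).
{ apply (interval_clopen (fun r => 0 <= r <= 1) (fun r => A (g r)) 0 1); try lra.
  - split; [intros; lra | exists 0, 1; lra].
  - intros r Hr. assert (Vr : V (g r)) by now apply HV.
    destruct (classic (A (g r))) as [h|h].
    + generalize (Hg A r HA h). apply filter_imp. tauto.
    + destruct (Hcov _ Vr) as [h'|h']; [contradiction|].
      generalize (Hg B r HB h'). apply filter_imp. intros z Bz Hz.
      assert (Vz : V (g z)) by now apply HV.
      split; [|contradiction]. intros Az. exfalso. apply Hn. now exists (g z).
  - unfold g. destruct p as [p1 p2]; simpl. now rewrite !Rmult_0_l, !Rplus_0_r. }
apply Hn. exists q. split; [exact Vq|]. split; [|exact Bq].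
unfold g in HA1. destruct p as [p1 p2], q as [q1 q2]; simpl in HA1.
now replace (p1 + 1 * (q1 - p1), p2 + 1 * (q2 - p2)) with (q1, q2) in HA1
  by (f_equal; ring).
Qed.

(** A class of functions that contains the components of the ruled surface below
    and is stable under partial derivatives, so that all orders of
    differentiability follow by one induction. *)
Definition trig_affine (a a' a'' b b' b'' c c' c'' : R) (u v : R) : R :=
  (a + a' * u + a'' * v) * cos v + (b + b' * u + b'' * v) * sin v
  + (c + c' * u + c'' * v).

Lemma ex_diff_n_trig_affine (n : nat) : forall a a' a'' b b' b'' c c' c'' u v,
  ex_diff_n (trig_affine a a' a'' b b' b'' c c' c'') n u v.
Proof.
induction n as [|n IH]; intros; simpl.
- split; auto.
  assert (Hcos := C1_at_cos v). assert (Hsin := C1_at_sin v).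
  assert (C : forall f : R -> R, C1_at f v -> continuity_2d_pt (fun _ v' => f v') u v).
  { intros f [Hf _]. apply continuity_2d_snd. apply (ex_derive_continuous f v).
    exact (locally_singleton _ _ Hf). }
  unfold trig_affine.
  repeat first [apply continuity_2d_pt_plus | apply continuity_2d_pt_mult
    | apply continuity_2d_pt_const | apply continuity_2d_pt_id1 | apply continuity_2d_pt_id2
    | apply (C cos Hcos) | apply (C sin Hsin)].
- split; [|split; [|split; [|split]]].
  + destruct n; apply IH.
  + unfold trig_affine. auto_derive; auto.
  + unfold trig_affine. auto_derive; auto.
  + apply (ex_diff_n_ext_loc (trig_affine a' 0 0 b' 0 0 c' 0 0)); [|apply IH].
    apply locally_2d_forall. intros u' v'. symmetry. apply is_derive_unique.
    unfold trig_affine. auto_derive; auto. ring.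
  + apply (ex_diff_n_ext_loc (trig_affine (a'' + b) b' b'' (b'' - a) (- a') (- a'') c'' 0 0));
      [|apply IH].
    apply locally_2d_forall. intros u' v'. symmetry. apply is_derive_unique.
    unfold trig_affine. auto_derive; auto. ring.
Qed.

Lemma sum_sqr_pos (a m : R) : m <> 0 -> 0 < a ^ 2 + m ^ 2.
Proof. intros Hm. generalize (pow2_ge_0 a) (pow2_gt_0 m Hm). lra. Qed.

(** For fixed [v] this is a horizontal line parametrized by arc length, at
    distance [|m|] from the axis.  In terms of [sg = u + m * v] the squared distance
    of a point to the axis is [sg ^ 2 + m ^ 2], so that the surface is the surface of
    revolution of the quadric curve with parameter [sg]. *)
Definition ruled (m k u v : R) : H1 :=
  (m * cos v + (u + m * v) * sin v, m * sin v - (u + m * v) * cos v, m * (u + m * v) + k).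

Lemma ruled_smooth (m k u v : R) (n : nat) :
  ex_diff_n (fun u' v' => px (ruled m k u' v')) n u v /\
  ex_diff_n (fun u' v' => py (ruled m k u' v')) n u v /\
  ex_diff_n (fun u' v' => pz (ruled m k u' v')) n u v.
Proof.
split; [|split].
- apply (ex_diff_n_ext_loc (trig_affine m 0 0 0 1 m 0 0 0)); [|apply ex_diff_n_trig_affine].
  apply locally_2d_forall. intros. unfold trig_affine, ruled, px; simpl. ring.
- apply (ex_diff_n_ext_loc (trig_affine 0 (-1) (- m) m 0 0 0 0 0)); [|apply ex_diff_n_trig_affine].
  apply locally_2d_forall. intros. unfold trig_affine, ruled, py; simpl. ring.
- apply (ex_diff_n_ext_loc (trig_affine 0 0 0 0 0 0 k m (m ^ 2))); [|apply ex_diff_n_trig_affine].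
  apply locally_2d_forall. intros. unfold trig_affine, ruled, pz; simpl. ring.
Qed.

Lemma d_fst_ruled (m k u v : R) : d_fst (ruled m k) u v = (sin v, - cos v, 0).
Proof.
unfold d_fst. rewrite (velocity_is_derive _ u (sin v) (- cos v) m).
- apply H1_eq; auto. unfold ruled, px, py; simpl.
  transitivity (m * (1 - (cos v ^ 2 + sin v ^ 2))); [ring | rewrite sin2_cos2_pow; ring].
- unfold ruled, px; simpl. auto_derive; auto; ring.
- unfold ruled, py; simpl. auto_derive; auto; ring.
- unfold ruled, pz; simpl. auto_derive; auto; ring.
Qed.

Lemma d_snd_ruled (m k u v : R) :
  d_snd (ruled m k) u v =
  ((u + m * v) * cos v, (u + m * v) * sin v, (u + m * v) ^ 2 + m ^ 2).
Proof.
unfold d_snd.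
rewrite (velocity_is_derive _ v ((u + m * v) * cos v) ((u + m * v) * sin v) (m ^ 2)).
- apply H1_eq; auto. unfold ruled, px, py; simpl.
  transitivity (m ^ 2 + (u + m * v) ^ 2 * (cos v ^ 2 + sin v ^ 2)); [ring | rewrite sin2_cos2_pow; ring].
- unfold ruled, px; simpl. auto_derive; auto; ring.
- unfold ruled, py; simpl. auto_derive; auto; ring.
- unfold ruled, pz; simpl. auto_derive; auto; ring.
Qed.

Lemma ruled_regular (m k u v : R) : m <> 0 -> regular (ruled m k) u v.
Proof.
intros Hm. assert (Hp := sum_sqr_pos (u + m * v) m Hm).
assert (Hcs := sin2_cos2_pow v). split.
- intros a b H. rewrite param_vectorE, d_fst_ruled, d_snd_ruled in H.
  injection H as E1 E2 E3.
  change (@eq R (a * sin v + b * ((u + m * v) * cos v)) 0) in E1.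
  change (@eq R (a * - cos v + b * ((u + m * v) * sin v)) 0) in E2.
  change (@eq R (a * 0 + b * ((u + m * v) ^ 2 + m ^ 2)) 0) in E3.
  assert (Hb : b = 0) by (apply (Rmult_eq_reg_r ((u + m * v) ^ 2 + m ^ 2)); lra).
  subst b. split; auto.
  transitivity (sin v * (a * sin v + 0 * ((u + m * v) * cos v))
    - cos v * (a * - cos v + 0 * ((u + m * v) * sin v))); [|rewrite E1, E2; ring].
  transitivity (a * (cos v ^ 2 + sin v ^ 2)); [rewrite Hcs|]; ring.
- intros H. destruct (H (param_vector (ruled m k) u v 0 1)) as [H' _].
  assert (H2 : in_xi (param_vector (ruled m k) u v 0 1)) by (apply H'; now exists 0, 1).
  rewrite param_vectorE, d_fst_ruled, d_snd_ruled in H2.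
  change (0 * 0 + 1 * ((u + m * v) ^ 2 + m ^ 2) = 0) in H2. lra.
Qed.

(** The height gives [u + m * v], after which the first two components determine
    [cos v] and [sin v] by an invertible linear system. *)
Lemma ruled_inj (m k u v u' v' : R) :
  m <> 0 -> Rabs (v - v') < 2 -> ruled m k u v = ruled m k u' v' -> u = u' /\ v = v'.
Proof.
intros Hm Hv H. injection H as E1 E2 E3.
assert (Hs : u + m * v = u' + m * v').
{ apply (Rmult_eq_reg_l m); lra. }
rewrite <- Hs in E1, E2. set (s := u + m * v) in *.
assert (Hp : m ^ 2 + s ^ 2 <> 0) by (generalize (sum_sqr_pos s m Hm); lra).
assert (Hvv : v = v').
{ apply cos_sin_inj; auto.
  - apply (Rmult_eq_reg_l (m ^ 2 + s ^ 2)); auto.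
    transitivity (m * (m * cos v + s * sin v) - s * (m * sin v - s * cos v)); [ring|].
    rewrite E1, E2. ring.
  - apply (Rmult_eq_reg_l (m ^ 2 + s ^ 2)); auto.
    transitivity (s * (m * cos v + s * sin v) + m * (m * sin v - s * cos v)); [ring|].
    rewrite E1, E2. ring. }
split; auto. unfold s in Hs. rewrite Hvv in Hs. lra.
Qed.

(** Here alpha is [sg / (sg ^ 2 + m ^ 2)] and the derivative in [v] is
    [sg ^ 2 + m ^ 2] times the vector [alpha e_2 + T], which is the normal form with
    [a = 0].  The bound on [d] keeps the angle [v] within less than a full turn. *)
Lemma ruled_normal_coordinates (m k u0 v0 d : R) :
  m <> 0 -> d <= 1 ->
  normal_coordinates (box u0 v0 d) (ruled m k) (fun v => m * v) (fun _ => m ^ 2).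
Proof.
intros Hm Hd. split; [|split].
- split; [apply box_is_open|]. split; [|split; [|split]].
  + apply convex_connected. intros p q r. apply box_convex.
  + intros u v _ n. apply ruled_smooth.
  + intros u v u' v' [_ H1] [_ H2]. simpl in H1, H2. apply ruled_inj; auto.
    apply Rabs_def2 in H1; apply Rabs_def2 in H2. apply Rabs_def1; lra.
  + intros u v _. now apply ruled_regular.
- intros u v _. rewrite d_fst_ruled. split; [reflexivity|].
  unfold adapted_norm, px, py, pz; simpl.
  match goal with |- sqrt ?A = 1 => replace A with 1; [apply sqrt_1|] end.
  transitivity (cos v ^ 2 + sin v ^ 2); [now rewrite sin2_cos2_pow | ring].
- intros u v _ den. set (s := u + m * v).
  assert (Hp := sum_sqr_pos s m Hm).
  fold s in den. change den with (s ^ 2 + m ^ 2). split; [lra|].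
  exists (s / (s ^ 2 + m ^ 2)), 0, (1 / (Rabs (s ^ 2 + m ^ 2) * sqrt (1 + (s / (s ^ 2 + m ^ 2)) ^ 2))).
  set (al := s / (s ^ 2 + m ^ 2)).
  assert (Hr : 0 < sqrt (1 + al ^ 2)) by (apply sqrt_lt_R0; nra).
  set (r := sqrt (1 + al ^ 2)) in *.
  split; [|split; [|split; [reflexivity | split; reflexivity]]].
  + exists 0, (/ (s ^ 2 + m ^ 2)).
    rewrite param_vectorE, d_fst_ruled, d_snd_ruled. fold s.
    transitivity ((al * - - cos v + 0, al * sin v + 0, al * 0 + 1) : H1); [reflexivity|].
    unfold al. apply H1_eq; unfold px, py, pz; simpl; field; lra.
  + rewrite param_vectorE, d_snd_ruled. fold s.
    unfold e2hat. rewrite d_fst_ruled. fold r.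
    transitivity ((/ r * (al * - - cos v + 0), / r * (al * sin v + 0), / r * (al * 0 + 1)) : H1);
      [reflexivity|].
    rewrite Rabs_pos_eq by lra.
    unfold al. apply H1_eq; unfold px, py, pz; simpl; field; lra.
Qed.
(** * Generating curves of p-minimal surfaces *)

Lemma velocity_hgen (x t vth : R -> R) (phi s : R) :
  ex_derive x s -> ex_derive t s -> ex_derive vth s ->
  velocity (hgen_curve x t vth phi) s =
  (Derive x s * cos (vth s + phi) - x s * Derive vth s * sin (vth s + phi),
   Derive x s * sin (vth s + phi) + x s * Derive vth s * cos (vth s + phi),
   Derive t s + x s ^ 2 * Derive vth s).
Proof.
intros Hx Ht Hv. assert (Hcs := sin2_cos2_pow (vth s + phi)).
erewrite velocity_is_derive.
2: { unfold hgen_curve, rot_surface, px; simpl. auto_derive; [now repeat split | reflexivity]. }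
2: { unfold hgen_curve, rot_surface, py; simpl. auto_derive; [now repeat split | reflexivity]. }
2: { unfold hgen_curve, rot_surface, pz; simpl. now apply Derive_correct. }
eta_derive. unfold hgen_curve, rot_surface, px, py; simpl.
apply H1_eq; [ring | ring |].
replace (x s * (x s * 1) * Derive vth s) with
  (x s ^ 2 * Derive vth s * (cos (vth s + phi) ^ 2 + sin (vth s + phi) ^ 2))
  by (rewrite Hcs; ring).
ring.
Qed.

Lemma adapted_norm_hgen (x t vth : R -> R) (phi s : R) :
  ex_derive x s -> ex_derive t s -> ex_derive vth s ->
  Derive t s + x s ^ 2 * Derive vth s = 0 ->
  adapted_norm (velocity (hgen_curve x t vth phi) s)
  = sqrt (Derive x s ^ 2 + x s ^ 2 * Derive vth s ^ 2).
Proof.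
intros Hx Ht Hv H0. rewrite velocity_hgen, H0 by auto.
unfold adapted_norm, px, py, pz; simpl. f_equal.
assert (Hcs := sin2_cos2_pow (vth s + phi)).
transitivity ((Derive x s ^ 2 + x s ^ 2 * Derive vth s ^ 2) *
  (cos (vth s + phi) ^ 2 + sin (vth s + phi) ^ 2)); [ring | rewrite Hcs; ring].
Qed.

Lemma C2_near_derivable (f : R -> R) (s : R) :
  C2_near f s -> ex_derive f s /\ ex_derive (Derive f) s.
Proof.
intros H. destruct (locally_singleton _ _ H) as [H0 _].
split; [exact (H0 1%nat (le_S _ _ (le_n _))) | exact (H0 2%nat (le_n _))].
Qed.

Section GeneratingCurve.
Variables (I : R -> Prop) (x t : R -> R).
Hypothesis gam : generating_curve I x t.

Lemma gen_interval : interval I.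
Proof. exact (proj1 gam). Qed.

Lemma gen_x_ge0 (s : R) : I s -> 0 <= x s.
Proof. exact (proj1 (proj2 gam) s). Qed.

Lemma gen_unit (s : R) : I s -> Derive x s ^ 2 + Derive t s ^ 2 = 1.
Proof. exact (proj1 (proj2 (proj2 gam)) s). Qed.

Lemma gen_C2 (s : R) : I s -> C2_near x s /\ C2_near t s.
Proof. exact (proj1 (proj2 (proj2 (proj2 gam))) s). Qed.

Lemma gen_ex_derive_x (s : R) : I s -> ex_derive x s.
Proof. intros Hs. exact (proj1 (C2_near_derivable _ _ (proj1 (gen_C2 s Hs)))). Qed.

Lemma gen_ex_derive_t (s : R) : I s -> ex_derive t s.
Proof. intros Hs. exact (proj1 (C2_near_derivable _ _ (proj2 (gen_C2 s Hs)))). Qed.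

Lemma gen_ex_derive_t' (s : R) : I s -> ex_derive (Derive t) s.
Proof. intros Hs. exact (proj2 (C2_near_derivable _ _ (proj2 (gen_C2 s Hs)))). Qed.

Lemma gen_smooth (s : R) : I s -> 0 < x s -> smooth_near x s /\ smooth_near t s.
Proof.
intros Hs Hx. destruct (proj1 (proj2 (proj2 (proj2 (proj2 gam)))) s Hs Hx) as [Sx St].
split; now apply Cinf_smooth_near.
Qed.

Lemma gen_speed2_pos (s : R) : I s -> 0 < x s -> 0 < speed2 x t s.
Proof. intros Hs Hx. apply speed2_pos; [lra | now apply gen_unit]. Qed.

(** The equation does not involve the angle, so that one meridian is enough in the
    direct implication. *)
Lemma rot_p_minimalP :
  rot_p_minimal I x t <-> (forall s, I s -> 0 < x s -> pmc_numerator x t s = 0).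
Proof.
split.
- intros H s Hs Hx. destruct (gen_smooth s Hs Hx) as [Sx St].
  destruct (H s 0 Hs) as (e & He & HH).
  + apply regular_rot; auto using gen_ex_derive_x, gen_ex_derive_t, gen_unit. lra.
  + apply (pmc_numerator_0_of_p_minimal_at x t s 0 e); auto. lra.
- intros H s th Hs Hr.
  apply regular_rot in Hr; auto using gen_ex_derive_x, gen_ex_derive_t, gen_unit.
  assert (Hx : 0 < x s) by (generalize (gen_x_ge0 s Hs); lra).
  destruct (gen_smooth s Hs Hx) as [Sx St].
  exists (rot_e1 x t). apply p_minimal_at_of_pmc_numerator_0; auto using gen_unit.
Qed.

Lemma pmc_numerator_0_of_const (k : R) :
  (forall s, I s -> t s = k) -> forall s, I s -> pmc_numerator x t s = 0.
Proof.
intros Hk.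
assert (H1 : forall s, I s -> Derive t s = 0).
{ intros s Hs. apply (derive_unique_within I t (fun _ => k) s); auto using gen_interval.
  - now apply Derive_correct, gen_ex_derive_t.
  - apply (is_derive_const k s). }
intros s Hs.
assert (H2 : Derive (Derive t) s = 0).
{ apply (derive_unique_within I (Derive t) (fun _ => 0) s); auto using gen_interval.
  - now apply Derive_correct, gen_ex_derive_t'.
  - apply (is_derive_const 0 s). }
unfold pmc_numerator. rewrite H1, H2 by auto. ring.
Qed.

(** Differentiating [t = m st + k] and [x ^ 2 = st ^ 2 + c2] along [I] and inserting
    both into [speed2 = (x st') ^ 2] gives [x ^ 2 = st ^ 2 + m ^ 2], whence [c2 = m ^ 2].
    On the axis horizontality would give [t' = 0], hence [st' = 0] because [m <> 0],
    and then [x' = 0], contrary to unit speed. *)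
Lemma quadric_facts (vth st : R -> R) (c2 m : R) :
  quadric_curve I x t vth st c2 m -> forall s, I s ->
  0 < x s /\ 0 < Derive st s /\ is_derive st s (Derive st s) /\
  Derive t s = m * Derive st s /\ x s * Derive x s = st s * Derive st s /\
  x s ^ 2 * Derive vth s = - Derive t s /\
  sqrt (speed2 x t s) = x s * Derive st s /\ c2 = m ^ 2.
Proof.
intros ((Hang & Hlen) & Hm & k & Hk) s Hs.
destruct (Hang s Hs) as [Dv Hxi]. specialize (Hlen s Hs).
assert (Dx := gen_ex_derive_x s Hs). assert (Dt := gen_ex_derive_t s Hs).
assert (Hu := gen_unit s Hs).
rewrite velocity_hgen in Hxi by auto.
change (Derive t s + x s ^ 2 * Derive vth s = 0) in Hxi.
rewrite adapted_norm_hgen in Hlen by auto.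
rewrite (is_derive_unique _ _ _ Hlen).
set (sg := sqrt (Derive x s ^ 2 + x s ^ 2 * Derive vth s ^ 2)) in *.
assert (Hsg : 0 <= sg) by apply sqrt_pos.
assert (Hsg2 : sg ^ 2 = Derive x s ^ 2 + x s ^ 2 * Derive vth s ^ 2).
{ unfold sg. rewrite <- Rsqr_pow2, Rsqr_sqrt; nra. }
assert (Ht : Derive t s = m * sg).
{ apply (derive_unique_within I t (fun r => m * st r + k) s); auto using gen_interval.
  - intros r Hr. now apply Hk.
  - now apply Derive_correct.
  - evar_last.
    + apply (is_derive_plus (fun r => m * st r) (fun _ => k)).
      * apply is_derive_scal. exact Hlen.
      * apply is_derive_const.
    + unfold plus, zero; simpl. ring. }
assert (Hxx : 2 * x s * Derive x s = 2 * st s * sg).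
{ apply (derive_unique_within I (fun r => x r ^ 2) (fun r => st r ^ 2 + c2) s);
    auto using gen_interval.
  - intros r Hr. now apply Hk.
  - auto_derive; auto. eta_ring.
  - auto_derive; [exists sg; exact Hlen|]. eta_derive.
    rewrite (is_derive_unique _ _ _ Hlen). ring. }
assert (Hx : 0 < x s).
{ destruct (Rle_lt_or_eq_dec _ _ (gen_x_ge0 s Hs)) as [h|h]; [exact h|exfalso].
  rewrite <- h in *.
  assert (Ht0 : Derive t s = 0) by lra. rewrite Ht0 in Ht.
  assert (sg = 0) by (apply (Rmult_eq_reg_l m); lra).
  rewrite Ht0 in Hu. nra. }
assert (HQ : speed2 x t s = (x s * sg) ^ 2).
{ unfold speed2. rewrite Rpow_mult_distr, Hsg2.
  replace (Derive t s) with (- (x s ^ 2 * Derive vth s)) by lra. ring. }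
assert (Hsg0 : sg <> 0).
{ intros h. assert (Hp := gen_speed2_pos s Hs Hx). rewrite HQ, h in Hp. nra. }
destruct (Hk s Hs) as [Hk1 _].
assert (Hc : st s ^ 2 + m ^ 2 = x s ^ 2).
{ apply (Rmult_eq_reg_r (sg ^ 2)); [|now apply pow_nonzero].
  transitivity (speed2 x t s); [|rewrite HQ; ring].
  unfold speed2. rewrite Ht. replace (x s ^ 2 * Derive x s ^ 2) with ((x s * Derive x s) ^ 2) by ring.
  replace (x s * Derive x s) with (st s * sg) by lra. ring. }
refine (conj Hx (conj _ (conj Hlen (conj Ht (conj _ (conj _ (conj _ _))))))); try lra.
rewrite HQ, sqrt_pow2; [ring|]. nra.
Qed.

Lemma quadric_energy (vth st : R -> R) (c2 m : R) :
  quadric_curve I x t vth st c2 m -> forall s, I s -> energy x t s = m.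
Proof.
intros H s Hs. destruct (quadric_facts _ _ _ _ H s Hs) as (Hx & Hd & _ & Ht & _ & _ & Hq & _).
unfold energy. change (x s ^ 2 * Derive x s ^ 2 + Derive t s ^ 2) with (speed2 x t s).
rewrite Hq, Ht. field. lra.
Qed.

Lemma quadric_arclength (vth st : R -> R) (c2 m : R) :
  quadric_curve I x t vth st c2 m -> forall s, I s -> radial_parameter x t s = st s.
Proof.
intros H s Hs. destruct (quadric_facts _ _ _ _ H s Hs) as (Hx & Hd & _ & _ & Hxx & _ & Hq & _).
unfold radial_parameter. rewrite Hq.
replace (x s ^ 2 * Derive x s) with (x s * (x s * Derive x s)) by ring.
rewrite Hxx. field. lra.
Qed.

(** The energy is the constant [m] and [radial_parameter] is [st]; comparison of the
    derivatives gives [x' h = 0] and [t' h = 0], where [x'] and [t'] do not vanish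
    together.  The second relation is what excludes the cylinders [x = const],
    whose energy is constant too. *)
Lemma pmc_numerator_0_of_quadric (vth st : R -> R) (c2 m : R) :
  quadric_curve I x t vth st c2 m -> forall s, I s -> pmc_numerator x t s = 0.
Proof.
intros H s Hs.
destruct (quadric_facts _ _ _ _ H s Hs) as (Hx & Hd & Hst & _ & _ & _ & Hq & _).
destruct (gen_smooth s Hs Hx) as [Sx St]. assert (Hu := gen_unit s Hs).
assert (Hx0 : x s <> 0) by lra.
assert (Hp := gen_speed2_pos s Hs Hx). assert (Hsq := sqrt_lt_R0 _ Hp).
assert (E1 := derive_unique_within I _ (fun _ => m) s _ _ gen_interval Hs
  (quadric_energy _ _ _ _ H) (is_derive_energy x t s Hx0 Hu Sx St) (is_derive_const m s)).
assert (E2 := derive_unique_within I _ st s _ _ gen_interval Hs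
  (quadric_arclength _ _ _ _ H) (is_derive_radial_parameter x t s Hx0 Hu Sx St) Hst).
change (@zero (NormedModule.AbelianMonoid R_AbsRing R_NormedModule)) with 0 in E1.
set (h := pmc_numerator x t s) in *.
set (w := speed2 x t s * sqrt (speed2 x t s)) in *.
assert (Hw : 0 < w) by (apply Rmult_lt_0_compat; auto).
assert (E1' : Derive x s * h = 0).
{ replace (Derive x s * h) with (Derive x s * h / w * w) by (field; lra). rewrite E1. apply Rmult_0_l. }
assert (E2' : Derive t s * h = 0).
{ assert (E : Derive t s * h / (x s * w) = 0).
  { rewrite Hq in E2. replace (x s * Derive st s / x s) with (Derive st s) in E2 by (field; lra). lra. }
  replace (Derive t s * h) with (Derive t s * h / (x s * w) * (x s * w)) by (field; lra).
  rewrite E. apply Rmult_0_l. }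
replace h with (h * (Derive x s ^ 2 + Derive t s ^ 2)) by (rewrite Hu; ring).
replace (h * (Derive x s ^ 2 + Derive t s ^ 2))
  with (Derive x s * (Derive x s * h) + Derive t s * (Derive t s * h)) by ring.
rewrite E1', E2'. ring.
Qed.

Lemma energy_le_x (s : R) : I s -> 0 < x s -> Rabs (energy x t s) <= x s.
Proof.
intros Hs Hx. assert (Hp := gen_speed2_pos s Hs Hx). assert (Hsq := sqrt_lt_R0 _ Hp).
assert (E : sqrt (speed2 x t s) ^ 2 = speed2 x t s) by (rewrite <- Rsqr_pow2, Rsqr_sqrt; lra).
unfold energy. change (x s ^ 2 * Derive x s ^ 2 + Derive t s ^ 2) with (speed2 x t s).
assert (Ht : Rabs (Derive t s) <= sqrt (speed2 x t s)).
{ rewrite <- (sqrt_pow2 (Rabs (Derive t s))) by apply Rabs_pos.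
  apply sqrt_le_1_alt. rewrite pow2_abs. unfold speed2. nra. }
unfold Rdiv. rewrite !Rabs_mult, (Rabs_pos_eq (x s)), (Rabs_pos_eq (/ _)) by
  (try apply Rlt_le, Rinv_0_lt_compat; lra).
apply (Rmult_le_reg_r (sqrt (speed2 x t s))); auto.
rewrite (Rmult_assoc _ (/ _)), Rinv_l by lra. nra.
Qed.

Lemma energy_locally_constant (s : R) :
  (forall r, I r -> 0 < x r -> pmc_numerator x t r = 0) -> I s -> 0 < x s ->
  locally s (fun r => I r -> energy x t r = energy x t s).
Proof.
intros Hh Hs Hx.
assert (Hpos : locally s (fun r => 0 < x r)).
{ refine (ex_derive_continuous x s (gen_ex_derive_x s Hs) (fun z => 0 < z) _).
  now apply (open_gt 0). }
destruct Hpos as [d Hd]. exists d. intros r Hr Ir.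
apply (derive0_within_const (fun q => I q /\ Rabs (q - s) < d)).
- intros p q c [Ip Hp] [Iq Hq] Hc. split.
  + now apply (proj1 gen_interval p q).
  + apply Rabs_def2 in Hp; apply Rabs_def2 in Hq. apply Rabs_def1; lra.
- intros q [Iq Hq]. specialize (Hd q Hq). simpl in Hd.
  destruct (gen_smooth q Iq Hd) as [Sx St].
  evar_last. { apply is_derive_energy; auto using gen_unit. lra. }
  rewrite Hh by auto. unfold Rdiv. ring.
- now split.
- split; auto. rewrite Rminus_diag, Rabs_R0; apply cond_pos.
Qed.

(** Near a point of the axis [|E| <= x] is smaller than [|m|], so having energy [m]
    off the axis is a locally constant property even there. *)
Lemma energy_propagates (s1 : R) :
  (forall r, I r -> 0 < x r -> pmc_numerator x t r = 0) ->
  I s1 -> 0 < x s1 -> energy x t s1 <> 0 ->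
  forall s, I s -> 0 < x s /\ energy x t s = energy x t s1.
Proof.
intros Hh Hs1 Hx1 Hm s Hs. set (m := energy x t s1) in *.
apply (interval_clopen I (fun r => 0 < x r /\ energy x t r = m) s1 s);
  auto using gen_interval.
clear s Hs. intros s Hs.
assert (Cx := ex_derive_continuous _ _ (gen_ex_derive_x s Hs)).
destruct (Rle_lt_or_eq_dec _ _ (gen_x_ge0 s Hs)) as [Hx|Hx].
- assert (Hpos : locally s (fun r => 0 < x r)).
  { refine (Cx (fun z => 0 < z) _). now apply (open_gt 0). }
  generalize (filter_and _ _ Hpos (energy_locally_constant s Hh Hs Hx)).
  apply filter_imp. intros r [Hr He] Ir. rewrite (He Ir). tauto.
- assert (Hsm : locally s (fun r => x r < Rabs m)).
  { refine (Cx (fun z => z < Rabs m) _). apply (open_lt (Rabs m)). simpl.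
    rewrite <- Hx. now apply Rabs_pos_lt. }
  generalize Hsm. apply filter_imp. intros r Hr Ir. split; [|lra].
  intros [Hxr He]. assert (Hle := energy_le_x r Ir Hxr). rewrite He in Hle. lra.
Qed.

(** The angle function [- atan (st / m)] has derivative
    [- m st' / (st ^ 2 + m ^ 2) = - t' / x ^ 2], as horizontality requires. *)
Lemma quadric_of_pmc_numerator_0 (s1 : R) :
  (forall r, I r -> 0 < x r -> pmc_numerator x t r = 0) ->
  I s1 -> 0 < x s1 -> energy x t s1 <> 0 ->
  exists vth st c2 m, quadric_curve I x t vth st c2 m.
Proof.
intros Hh Hs1 Hx1 Hm. assert (Hall := energy_propagates s1 Hh Hs1 Hx1 Hm).
set (m := energy x t s1) in *. set (st := radial_parameter x t).
exists (fun s => - atan (st s / m)), st, (m ^ 2), m.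
assert (Hst : forall s, I s -> is_derive st s (sqrt (speed2 x t s) / x s)).
{ intros s Hs. destruct (Hall s Hs) as [Hx _]. destruct (gen_smooth s Hs Hx) as [Sx St].
  evar_last. { apply is_derive_radial_parameter; auto using gen_unit. lra. }
  rewrite Hh by auto. unfold Rdiv. ring. }
assert (Hmt : forall s, I s -> m * sqrt (speed2 x t s) = x s * Derive t s).
{ intros s Hs. destruct (Hall s Hs) as [Hx He]. rewrite <- He.
  assert (Hp := sqrt_lt_R0 _ (gen_speed2_pos s Hs Hx)).
  unfold energy. change (x s ^ 2 * Derive x s ^ 2 + Derive t s ^ 2) with (speed2 x t s).
  field. lra. }
assert (Hx2 : forall s, I s -> x s ^ 2 = st s ^ 2 + m ^ 2).
{ intros s Hs. destruct (Hall s Hs) as [Hx He].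
  assert (Hp0 := gen_speed2_pos s Hs Hx). assert (Hp := sqrt_lt_R0 _ Hp0).
  assert (E : sqrt (speed2 x t s) ^ 2 = speed2 x t s) by (rewrite <- Rsqr_pow2, Rsqr_sqrt; lra).
  replace m with (x s * Derive t s / sqrt (speed2 x t s)) by (rewrite <- Hmt by auto; field; lra).
  unfold st, radial_parameter.
  transitivity (x s ^ 2 * speed2 x t s / sqrt (speed2 x t s) ^ 2).
  - rewrite E. field. lra.
  - unfold speed2 at 1. field. lra. }
assert (Hv : forall s, I s -> is_derive (fun s => - atan (st s / m)) s (- Derive t s / x s ^ 2)).
{ intros s Hs. destruct (Hall s Hs) as [Hx _].
  auto_derive; [eexists; now apply Hst|]. eta_derive.
  rewrite (is_derive_unique _ _ _ (Hst s Hs)).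
  assert (Hd := Hmt s Hs). assert (Hd2 := Hx2 s Hs).
  replace (Derive t s) with (m * sqrt (speed2 x t s) / x s) by (rewrite Hd; field; lra).
  rewrite Hd2. assert (st s ^ 2 + m ^ 2 <> 0) by nra.
  field. repeat split; lra. }
assert (Hv' : forall s, I s ->
  Derive (fun s : R => - atan (st s / m)) s = - Derive t s / x s ^ 2)
  by (intros s Hs; exact (is_derive_unique _ _ _ (Hv s Hs))).
split; [|split; [exact Hm|]].
- split.
  + intros s Hs. destruct (Hall s Hs) as [Hx _].
    assert (Dv : ex_derive (fun s => - atan (st s / m)) s) by (eexists; now apply Hv).
    split; [exact Dv|].
    rewrite velocity_hgen by auto using gen_ex_derive_x, gen_ex_derive_t.
    change (Derive t s + x s ^ 2 * Derive (fun s : R => - atan (st s / m)) s = 0).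
    rewrite Hv' by exact Hs. field. lra.
  + intros s Hs. destruct (Hall s Hs) as [Hx _].
    assert (Dv : ex_derive (fun s => - atan (st s / m)) s) by (eexists; now apply Hv).
    assert (Hp0 := gen_speed2_pos s Hs Hx).
    rewrite adapted_norm_hgen; auto using gen_ex_derive_x, gen_ex_derive_t.
    2: { rewrite Hv' by exact Hs. field. lra. }
    rewrite Hv' by exact Hs.
    evar_last; [now apply Hst|].
    replace (Derive x s ^ 2 + x s ^ 2 * (- Derive t s / x s ^ 2) ^ 2)
      with (speed2 x t s / x s ^ 2) by (unfold speed2; field; lra).
    rewrite sqrt_div_alt by nra. rewrite sqrt_pow2 by lra. reflexivity.
- exists (t s1 - m * st s1). intros s Hs. split; [now apply Hx2|].
  assert (E : t s - m * st s = t s1 - m * st s1); [|lra].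
  apply (derive0_within_const I (fun r => t r - m * st r)); auto.
  + apply gen_interval.
  + clear s Hs. intros s Hs. destruct (Hall s Hs) as [Hx _].
    evar_last.
    { apply (is_derive_minus t (fun r => m * st r)).
      - now apply Derive_correct, gen_ex_derive_t.
      - apply is_derive_scal. now apply Hst. }
    unfold minus, plus, opp; simpl.
    replace (m * (sqrt (speed2 x t s) / x s)) with (m * sqrt (speed2 x t s) / x s) by (field; lra).
    rewrite Hmt by auto. field. lra.
Qed.

(** If the curve reaches the axis with [t' = 0], then [x' <> 0] by unit speed, so it
    is off the axis at all other nearby parameters, where [t' = 0] again; thus the
    vanishing of [t'] is locally constant. *)
Lemma t_const_of_zero_energy :
  (forall s, I s -> 0 < x s -> Derive t s = 0) -> exists k, forall s, I s -> t s = k.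
Proof.
intros H0. destruct gam as (_ & _ & _ & _ & _ & (s0 & Hs0 & Hx0)).
assert (Ht : forall s, I s -> Derive t s = 0).
{ intros s Hs. apply NNPP; intros Hne.
  apply (interval_clopen I (fun r => Derive t r <> 0) s s0); auto using gen_interval.
  clear s Hs Hne. intros s Hs.
  destruct (Req_dec (Derive t s) 0) as [E|E].
  - assert (Hloc : locally s (fun r => I r -> Derive t r = 0)).
    2: { generalize Hloc. apply filter_imp. intros r Hr Ir. rewrite (Hr Ir). tauto. }
    destruct (Rle_lt_or_eq_dec _ _ (gen_x_ge0 s Hs)) as [Hx|Hx].
    + assert (Hpos : locally s (fun r => 0 < x r)).
      { refine (ex_derive_continuous x s (gen_ex_derive_x s Hs) (fun z => 0 < z) _).
        now apply (open_gt 0). }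
      generalize Hpos. apply filter_imp. auto.
    + assert (Hu := gen_unit s Hs). rewrite E in Hu.
      assert (Hd := Derive_correct _ _ (gen_ex_derive_x s Hs)).
      apply is_derive_Reals in Hd.
      destruct (Hd 1) as [d Hd1]; [lra|].
      exists d. intros r Hr Ir. simpl in r.
      destruct (Req_dec r s) as [->|Hrs]; auto.
      apply H0; auto.
      destruct (Rle_lt_or_eq_dec _ _ (gen_x_ge0 r Ir)) as [Hxr|Hxr]; auto. exfalso.
      assert (Hd2 := Hd1 (r - s)). replace (s + (r - s)) with r in Hd2 by ring.
      rewrite <- Hxr, <- Hx in Hd2.
      assert (Hc : Rabs ((0 - 0) / (r - s) - Derive x s) < 1) by (apply Hd2; [lra | exact Hr]).
      replace ((0 - 0) / (r - s) - Derive x s) with (- Derive x s) in Hc by (field; lra).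
      apply Rabs_def2 in Hc. nra.
  - assert (Hloc : locally s (fun r => Derive t r <> 0)).
    { refine (ex_derive_continuous (Derive t) s (gen_ex_derive_t' s Hs) (fun z => z <> 0) _).
      now apply (open_neq 0). }
    generalize Hloc. apply filter_imp. intros r Hr _. tauto. }
exists (t s0). intros s Hs.
apply (derive0_within_const I t); auto.
- apply gen_interval.
- intros r Hr. rewrite <- (Ht r Hr). now apply Derive_correct, gen_ex_derive_t.
Qed.

Lemma classification :
  rot_p_minimal I x t <->
  ((exists k, forall s, I s -> t s = k) \/
   (exists vth st c2 m, quadric_curve I x t vth st c2 m)).
Proof.
rewrite rot_p_minimalP. split.
- intros Hh.
  destruct (classic (exists s, I s /\ 0 < x s /\ energy x t s <> 0))
    as [(s1 & Hs1 & Hx1 & Hm)|Hn].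
  + right. now apply (quadric_of_pmc_numerator_0 s1).
  + left. apply t_const_of_zero_energy. intros s Hs Hx.
    apply NNPP; intros Ht. apply Hn. exists s. split; [|split]; auto.
    assert (Hp := sqrt_lt_R0 _ (gen_speed2_pos s Hs Hx)).
    apply Rmult_integral_contrapositive_currified.
    * apply Rmult_integral_contrapositive_currified; lra.
    * apply Rinv_neq_0_compat. unfold speed2 in Hp. lra.
- intros [[k Hk]|(vth & st & c2 & m & H)] s Hs _.
  + now apply (pmc_numerator_0_of_const k).
  + now apply (pmc_numerator_0_of_quadric vth st c2 m).
Qed.
(** * The invariants in arbitrary normal coordinates *)

Lemma quadric_x2_t (vth st : R -> R) (c2 m : R) :
  quadric_curve I x t vth st c2 m ->
  exists k, forall s, I s -> x s ^ 2 = st s ^ 2 + m ^ 2 /\ t s = m * st s + k.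
Proof.
intros H. generalize H. intros (_ & _ & k & Hk). exists k. intros s Hs.
destruct (quadric_facts _ _ _ _ H s Hs) as (_ & _ & _ & _ & _ & _ & _ & Hc).
rewrite <- Hc. now apply Hk.
Qed.

(** What a patch inherits from the horizontal generating curves, freed from the
    parameter of the curve and from the angle: the implicit equation of the
    surface, and the radial and angular components of e_1 multiplied by the
    distance to the axis. *)
Lemma patch_first_order (vth st : R -> R) (c2 m k : R) (V : R * R -> Prop) (Y : R -> R -> H1) :
  quadric_curve I x t vth st c2 m ->
  (forall s, I s -> x s ^ 2 = st s ^ 2 + m ^ 2 /\ t s = m * st s + k) ->
  patch_of_rot I x t vth st V Y ->
  forall u v, V (u, v) ->
  let sg := (pz (Y u v) - k) / m in
  px (Y u v) ^ 2 + py (Y u v) ^ 2 = sg ^ 2 + m ^ 2 /\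
  px (Y u v) * px (d_fst Y u v) + py (Y u v) * py (d_fst Y u v) = sg /\
  px (Y u v) * py (d_fst Y u v) - py (Y u v) * px (d_fst Y u v) = - m /\
  pz (d_fst Y u v) = 0.
Proof.
intros HQ Hk HP u v Huv sg.
destruct (HP u v Huv) as (s & phi & Hs & HY & Hd).
destruct (quadric_facts _ _ _ _ HQ s Hs) as (Hx & Hst & _ & Ht & Hxx & Hv & _ & _).
destruct HQ as ((Hang & _) & Hm & _).
destruct (Hang s Hs) as [Dv _]. destruct (Hk s Hs) as [Hx2 Htk].
rewrite velocity_hgen in Hd by auto using gen_ex_derive_x, gen_ex_derive_t.
set (D := d_fst Y u v) in *.
assert (E1 := f_equal px Hd). assert (E2 := f_equal py Hd). assert (E3 := f_equal pz Hd).
change (Derive st s * px D = Derive x s * cos (vth s + phi) - x s * Derive vth s * sin (vth s + phi)) in E1.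
change (Derive st s * py D = Derive x s * sin (vth s + phi) + x s * Derive vth s * cos (vth s + phi)) in E2.
change (Derive st s * pz D = Derive t s + x s ^ 2 * Derive vth s) in E3.
assert (Hsg : sg = st s).
{ unfold sg. rewrite HY. change (pz (hgen_curve x t vth phi s)) with (t s). rewrite Htk. field. auto. }
rewrite Hsg, HY. clear sg Hsg.
change (px (hgen_curve x t vth phi s)) with (x s * cos (vth s + phi)).
change (py (hgen_curve x t vth phi s)) with (x s * sin (vth s + phi)).
assert (Hcs := sin2_cos2_pow (vth s + phi)).
set (c := cos (vth s + phi)) in *. set (n := sin (vth s + phi)) in *.
split; [|split; [|split]].
- transitivity (x s ^ 2 * (c ^ 2 + n ^ 2)); [ring | rewrite Hcs; lra].
- apply (Rmult_eq_reg_l (Derive st s)); [|lra].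
  transitivity (x s * c * (Derive st s * px D) + x s * n * (Derive st s * py D)); [ring|].
  rewrite E1, E2. transitivity (x s * Derive x s * (c ^ 2 + n ^ 2)); [ring|].
  rewrite Hcs. lra.
- apply (Rmult_eq_reg_l (Derive st s)); [|lra].
  transitivity (x s * c * (Derive st s * py D) - x s * n * (Derive st s * px D)); [ring|].
  rewrite E1, E2. transitivity (x s ^ 2 * Derive vth s * (c ^ 2 + n ^ 2)); [ring|].
  rewrite Hcs. lra.
- apply (Rmult_eq_reg_l (Derive st s)); [|lra]. lra.
Qed.

Lemma is_derive_affine (f : R -> R) (s k m : R) :
  ex_derive f s -> is_derive (fun r => (f r - k) / m) s (Derive f s / m).
Proof. intros Hf. auto_derive; auto. unfold Rdiv. eta_ring. Qed.

Lemma Derive_quadric (f g h : R -> R) (s m : R) :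
  ex_derive f s -> ex_derive g s -> ex_derive h s ->
  Derive (fun r => f r ^ 2 + g r ^ 2 - (h r ^ 2 + m ^ 2)) s
  = 2 * f s * Derive f s + 2 * g s * Derive g s - 2 * h s * Derive h s.
Proof. intros. apply is_derive_unique. auto_derive; auto. eta_ring. Qed.

(** The difference of the two sides is a polynomial of degree two in [e] with
    leading coefficient [sg - p]; three equidistant zeros kill its second
    difference [2 h ^ 2 (sg - p)], and what remains is [(m2 - z) (sg + e)]. *)
Lemma invariants_from_alpha (sg p m2 z h : R) :
  0 < h ->
  (forall e, e = 0 \/ e = h \/ e = - h ->
     (p + e) * ((sg + e) ^ 2 + m2) = (sg + e) * ((p + e) ^ 2 + z)) ->
  p = sg /\ z = m2.
Proof.
intros Hh H.
assert (H0 := H 0 (or_introl eq_refl)).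
assert (H1 := H h (or_intror (or_introl eq_refl))).
assert (H2 := H (- h) (or_intror (or_intror eq_refl))).
assert (E : p = sg).
{ apply Rminus_diag_uniq. apply (Rmult_eq_reg_l (2 * h ^ 2)); [|nra]. nra. }
subst p. split; auto. nra.
Qed.

(** In normal coordinates [a = 0] and the normal form of [b] cancels the factor
    normalizing [e2hat], so that the derivative in the second coordinate is
    [|den| (alpha e_2 + T)]. *)
Lemma normal_coordinates_d_snd (V : R * R -> Prop) (Y : R -> R -> H1) (zeta1 zeta2 : R -> R) :
  normal_coordinates V Y zeta1 zeta2 -> forall u v, V (u, v) ->
  let p := u + zeta1 v in let den := p ^ 2 + zeta2 v in
  den <> 0 /\
  px (d_snd Y u v) = - (Rabs den * (p / den) * py (d_fst Y u v)) /\
  py (d_snd Y u v) = Rabs den * (p / den) * px (d_fst Y u v) /\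
  pz (d_snd Y u v) = Rabs den.
Proof.
intros (_ & _ & HN) u v Huv p den.
destruct (HN u v Huv) as (Hden & alpha & a & b & _ & He & Ha & Ha0 & Hb).
fold p in Hden, Ha, Hb. fold den in Hden, Ha, Hb. rewrite <- Ha.
assert (Hr : 0 < sqrt (1 + alpha ^ 2)) by (apply sqrt_lt_R0; nra).
assert (Hd : 0 < Rabs den) by now apply Rabs_pos_lt.
set (r := sqrt (1 + alpha ^ 2)) in *.
set (F := d_fst Y u v) in *. set (G := d_snd Y u v) in *.
assert (E1 := f_equal px He). assert (E2 := f_equal py He). assert (E3 := f_equal pz He).
change (/ r * (alpha * - py F + 0) = a * px F + b * px G) in E1.
change (/ r * (alpha * px F + 0) = a * py F + b * py G) in E2.
change (/ r * (alpha * 0 + 1) = a * pz F + b * pz G) in E3.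
rewrite Ha0, Hb in E1, E2, E3.
split; [exact Hden|].
assert (Hc : forall f g w, / r * w = 0 * f + 1 / (Rabs den * r) * g -> g = Rabs den * w).
{ intros f g w E. replace g with (Rabs den * r * (0 * f + 1 / (Rabs den * r) * g)) by (field; lra).
  rewrite <- E. field. lra. }
apply Hc in E1, E2, E3. rewrite E1, E2, E3. repeat split; ring.
Qed.

Lemma normal_coordinates_smooth (V : R * R -> Prop) (Y : R -> R -> H1) (zeta1 zeta2 : R -> R) :
  normal_coordinates V Y zeta1 zeta2 -> forall u v, V (u, v) ->
  (ex_derive (fun r => px (Y r v)) u /\ ex_derive (fun r => px (Y u r)) v) /\
  (ex_derive (fun r => py (Y r v)) u /\ ex_derive (fun r => py (Y u r)) v) /\
  (ex_derive (fun r => pz (Y r v)) u /\ ex_derive (fun r => pz (Y u r)) v).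
Proof.
intros [(_ & _ & HS & _) _] u v Huv.
destruct (HS u v Huv 1%nat) as ((_ & A1 & A2 & _) & (_ & B1 & B2 & _) & (_ & C1 & C2 & _)).
exact (conj (conj A1 A2) (conj (conj B1 B2) (conj C1 C2))).
Qed.

(** The numerator and the denominator of alpha are identified from the dependence
    on [u] for fixed [v]; only then is the sign of the denominator known, and the
    dependence of [zeta1] on [v] can be read off from the derivative of [sg]. *)
Lemma normal_invariants (vth st : R -> R) (c2 m : R)
  (V : R * R -> Prop) (Y : R -> R -> H1) (zeta1 zeta2 : R -> R) :
  quadric_curve I x t vth st c2 m ->
  normal_coordinates V Y zeta1 zeta2 ->
  patch_of_rot I x t vth st V Y ->
  exists c, forall u v, V (u, v) -> zeta1 v = m * v + c /\ zeta2 v = c2.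
Proof.
intros HQ HN HP.
assert (Hm : m <> 0) by apply HQ.
assert (Hc2 : c2 = m ^ 2).
{ destruct gam as (_ & _ & _ & _ & _ & s & Hs & _).
  now destruct (quadric_facts _ _ _ _ HQ s Hs) as (_ & _ & _ & _ & _ & _ & _ & Hc). }
destruct (quadric_x2_t _ _ _ _ HQ) as [k Hk].
assert (HF := patch_first_order vth st c2 m k V Y HQ Hk HP).
assert (HD := normal_coordinates_d_snd V Y zeta1 zeta2 HN).
assert (HS := normal_coordinates_smooth V Y zeta1 zeta2 HN).
assert (HV : open V) by apply HN.
set (sg := fun u v => (pz (Y u v) - k) / m) in *.
(* horizontality of the lines v = const turns their angular component - m into
   the height rate m *)
assert (Hsu : forall u v, V (u, v) -> is_derive (fun r => sg r v) u 1).
{ intros u v Huv. destruct (HS u v Huv) as (_ & _ & Cz & _).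
  destruct (HF u v Huv) as (_ & _ & Hcr & H0).
  change (pz (d_fst Y u v)) with (Derive (fun r => pz (Y r v)) u
    + px (Y u v) * py (d_fst Y u v) - py (Y u v) * px (d_fst Y u v)) in H0.
  evar_last; [exact (is_derive_affine (fun r => pz (Y r v)) u k m Cz)|].
  replace (Derive (fun r => pz (Y r v)) u) with m by lra. field. auto. }
assert (Hpzv : forall u v, V (u, v) ->
  Derive (fun r => pz (Y u r)) v =
  pz (d_snd Y u v) - px (Y u v) * py (d_snd Y u v) + py (Y u v) * px (d_snd Y u v)).
{ intros u v _. change (pz (d_snd Y u v)) with (Derive (fun r => pz (Y u r)) v
    + px (Y u v) * py (d_snd Y u v) - py (Y u v) * px (d_snd Y u v)). ring. }
(* the implicit equation of the surface, differentiated in v, gives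
   alpha = sg / (sg^2 + m^2) *)
assert (Halpha : forall u v, V (u, v) ->
  let p := u + zeta1 v in p * (sg u v ^ 2 + m ^ 2) = sg u v * (p ^ 2 + zeta2 v)).
{ intros u v Huv p.
  destruct (HS u v Huv) as ((_ & Ax) & (_ & Ay) & (_ & Az)).
  destruct (HF u v Huv) as (_ & Hdot & Hcr & _). fold (sg u v) in Hdot.
  destruct (HD u v Huv) as (Hden & G1 & G2 & G3). fold p in Hden, G1, G2, G3.
  assert (Hz := Hpzv u v Huv). rewrite G1, G2, G3 in Hz.
  set (den := p ^ 2 + zeta2 v) in *.
  assert (Hsurf : Derive (fun r => px (Y u r) ^ 2 + py (Y u r) ^ 2 - (sg u r ^ 2 + m ^ 2)) v = 0).
  { rewrite (Derive_ext_loc _ (fun _ => 0)); [apply Derive_const|].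
    destruct (box_of_open V u v HV Huv) as [d Hd]. exists d. intros r Hr.
    assert (Hur : V (u, r)).
    { apply Hd; auto. rewrite Rminus_diag, Rabs_R0; apply cond_pos. }
    destruct (HF u r Hur) as (Hq & _). fold (sg u r) in Hq. lra. }
  assert (Hsurf' : Derive (fun r => px (Y u r) ^ 2 + py (Y u r) ^ 2 - (sg u r ^ 2 + m ^ 2)) v
    = 2 * px (Y u v) * px (d_snd Y u v) + 2 * py (Y u v) * py (d_snd Y u v)
      - 2 * sg u v * (Derive (fun r => pz (Y u r)) v / m)).
  { assert (Hsg := is_derive_affine (fun r => pz (Y u r)) v k m Az).
    rewrite <- (is_derive_unique _ _ _ Hsg).
    exact (Derive_quadric (fun r => px (Y u r)) (fun r => py (Y u r)) (fun r => sg u r) v m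
      Ax Ay (ex_intro _ _ Hsg)). }
  rewrite Hsurf, G1, G2, Hz in Hsurf'.
  assert (Hd : 0 < Rabs den) by now apply Rabs_pos_lt.
  set (al := p / den) in *.
  assert (E : 2 * Rabs den / m * (al * (sg u v ^ 2 + m ^ 2) - sg u v) = 0).
  { rewrite Hsurf'.
    set (X := px (Y u v)) in *. set (Z := py (Y u v)) in *.
    set (f1 := px (d_fst Y u v)) in *. set (f2 := py (d_fst Y u v)) in *.
    symmetry. transitivity (2 * Rabs den * al * - (X * f2 - Z * f1)
      - 2 * sg u v * Rabs den * (1 - al * (X * f1 + Z * f2)) / m); [field; auto|].
    rewrite Hcr, Hdot. field. auto. }
  apply Rmult_integral in E. destruct E as [E|E].
  - exfalso. revert E. apply Rmult_integral_contrapositive_currified; [lra|].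
    now apply Rinv_neq_0_compat.
  - assert (E' : sg u v = al * (sg u v ^ 2 + m ^ 2)) by lra.
    transitivity (den * (al * (sg u v ^ 2 + m ^ 2))).
    + unfold al. field. auto.
    + rewrite <- E'. ring. }
assert (Hz : forall u v, V (u, v) -> u + zeta1 v = sg u v /\ zeta2 v = m ^ 2).
{ intros u v Huv. destruct (box_of_open V u v HV Huv) as [d Hd]. assert (Hdp := cond_pos d).
  assert (Hv0 : Rabs (v - v) < d) by (rewrite Rminus_diag, Rabs_R0; lra).
  apply (invariants_from_alpha _ _ _ _ (d / 2)); [lra|].
  intros e He.
  assert (Hed : Rabs (u + e - u) < d).
  { replace (u + e - u) with e by ring. apply Rabs_def1; lra. }
  assert (Hs : sg (u + e) v = sg u v + e).
  { assert (E : sg (u + e) v - (u + e) = sg u v - u); [|lra].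
    apply (derive0_segment (fun r => sg r v - r) u (u + e) d); auto.
    intros r Hr. evar_last.
    { apply (is_derive_minus (fun r => sg r v) (fun r => r)); [now apply Hsu, Hd|].
      apply (is_derive_id r). }
    apply Rminus_diag. }
  assert (Ha := Halpha (u + e) v (Hd _ _ Hed Hv0)). simpl in Ha. rewrite Hs in Ha.
  replace (u + zeta1 v + e) with (u + e + zeta1 v) by ring. simpl. exact Ha. }
(* now den = sg^2 + m^2 > 0, and the rate of the height in v is m^2 *)
assert (Hsv : forall u v, V (u, v) -> is_derive (fun r => sg u r) v m).
{ intros u v Huv. destruct (HS u v Huv) as (_ & _ & _ & Cz).
  destruct (HF u v Huv) as (_ & Hdot & Hcr & _). fold (sg u v) in Hdot.
  destruct (HD u v Huv) as (Hden & G1 & G2 & G3).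
  destruct (Hz u v Huv) as [Z1 Z2]. rewrite Z1, Z2 in Hden, G1, G2, G3.
  assert (Hm2 : 0 < m ^ 2) by nra.
  assert (Hp : 0 < sg u v ^ 2 + m ^ 2) by nra.
  rewrite Rabs_pos_eq in G1, G2, G3 by lra.
  evar_last; [exact (is_derive_affine (fun r => pz (Y u r)) v k m Cz)|].
  rewrite (Hpzv u v Huv), G1, G2, G3.
  transitivity ((sg u v ^ 2 + m ^ 2 - sg u v * (px (Y u v) * px (d_fst Y u v)
     + py (Y u v) * py (d_fst Y u v))) / m); [field; lra|].
  rewrite Hdot. field. auto. }
destruct (partials0_const V (fun u v => sg u v - u - m * v)) as [c Hc].
- exact HV.
- apply HN.
- intros u v Huv. assert (D1 := Hsu u v Huv). assert (D2 := Hsv u v Huv). split.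
  + evar_last.
    { apply (is_derive_minus (fun r => sg r v - r) (fun _ => m * v)).
      - apply (is_derive_minus (fun r => sg r v) (fun r => r)); [exact D1 | apply (is_derive_id u)].
      - apply is_derive_const. }
    unfold minus, plus, opp, one, zero; simpl. ring.
  + evar_last.
    { apply (is_derive_minus (fun r => sg u r - u) (fun r => m * r)).
      - apply (is_derive_minus (fun r => sg u r) (fun _ => u)); [exact D2 | apply is_derive_const].
      - apply is_derive_scal. apply (is_derive_id v). }
    unfold minus, plus, opp, one, zero; simpl. ring.
- exists c. intros u v Huv. destruct (Hz u v Huv) as [Z1 Z2]. specialize (Hc u v Huv).
  simpl in Hc. split; [lra | now rewrite Hc2].
Qed.
(** * Normal coordinates through a given point *)

Lemma ruled_patch_of_rot (vth st : R -> R) (c2 m k : R) (V : R * R -> Prop) :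
  quadric_curve I x t vth st c2 m ->
  (forall s, I s -> x s ^ 2 = st s ^ 2 + m ^ 2 /\ t s = m * st s + k) ->
  (forall u v, V (u, v) -> exists s, I s /\ st s = u + m * v) ->
  patch_of_rot I x t vth st V (ruled m k).
Proof.
intros HQ Hk HV u v Huv. destruct (HV u v Huv) as (s & Hs & Hst).
destruct (quadric_facts _ _ _ _ HQ s Hs) as (Hx & _ & _ & Ht & Hxx & Hv & _ & _).
destruct HQ as ((Hang & _) & Hm & _).
destruct (Hang s Hs) as [Dv _]. destruct (Hk s Hs) as [Hx2 Htk].
assert (Hcs := sin2_cos2_pow v).
rewrite Hst in *. set (sg := u + m * v) in *.
destruct (unit_circle_angle ((m * cos v + sg * sin v) / x s) ((m * sin v - sg * cos v) / x s))
  as (w & Hw1 & Hw2).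
{ transitivity ((sg ^ 2 + m ^ 2) * (cos v ^ 2 + sin v ^ 2) / x s ^ 2).
  - field. lra.
  - rewrite Hcs, <- Hx2. field. lra. }
exists s, (w - vth s). split; [exact Hs|].
assert (Hphi : vth s + (w - vth s) = w) by ring.
split.
- unfold hgen_curve, rot_surface, ruled. fold sg. rewrite Hphi, Hw1, Hw2.
  apply H1_eq; [field; lra | field; lra | lra].
- rewrite velocity_hgen by auto using gen_ex_derive_x, gen_ex_derive_t.
  rewrite Hphi, Hw1, Hw2, d_fst_ruled.
  transitivity ((Derive st s * sin v, Derive st s * - cos v, Derive st s * 0) : H1);
    [reflexivity|].
  assert (H1' : Derive x s = sg * Derive st s / x s) by (rewrite <- Hxx; field; lra).
  assert (H2' : Derive vth s = - (m * Derive st s) / x s ^ 2) by (rewrite <- Ht, <- Hv; field; lra).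
  apply H1_eq; [| | lra]; rewrite H1', H2'.
  + transitivity (Derive st s * (sg ^ 2 + m ^ 2) * sin v / x s ^ 2).
    * rewrite <- Hx2. field. lra.
    * field. lra.
  + transitivity (Derive st s * (sg ^ 2 + m ^ 2) * - cos v / x s ^ 2).
    * rewrite <- Hx2. field. lra.
    * field. lra.
Qed.

Lemma ruled_through (m k s0 x0 th : R) :
  0 < x0 -> x0 ^ 2 = s0 ^ 2 + m ^ 2 ->
  exists u v, u + m * v = s0 /\ ruled m k u v = (x0 * cos th, x0 * sin th, m * s0 + k).
Proof.
intros Hx Hx2. assert (Hcs := sin2_cos2_pow th).
destruct (unit_circle_angle ((m * cos th - s0 * sin th) / x0) ((s0 * cos th + m * sin th) / x0))
  as (v & Hc & Hn).
{ transitivity ((s0 ^ 2 + m ^ 2) * (cos th ^ 2 + sin th ^ 2) / x0 ^ 2).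
  - field. lra.
  - rewrite Hcs, <- Hx2. field. lra. }
exists (s0 - m * v), v. split; [ring|].
unfold ruled. replace (s0 - m * v + m * v) with s0 by ring. rewrite Hc, Hn.
apply H1_eq; [| | ring].
- transitivity ((s0 ^ 2 + m ^ 2) * cos th / x0); [field; lra|]. rewrite <- Hx2. field. lra.
- transitivity ((s0 ^ 2 + m ^ 2) * sin th / x0); [field; lra|]. rewrite <- Hx2. field. lra.
Qed.

(** The arc-length parameter is strictly increasing, so it covers a neighbourhood
    of its value at an interior point. *)
Lemma quadric_st_onto (vth st : R -> R) (c2 m s0 : R) :
  quadric_curve I x t vth st c2 m -> locally s0 I ->
  exists d : posreal, forall y, Rabs (y - st s0) < d -> exists s, I s /\ st s = y.
Proof.
intros HQ [e He]. assert (Hep := cond_pos e).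
assert (HI : forall r, Rabs (r - s0) < e -> I r) by exact He.
set (a := s0 - e / 2). set (b := s0 + e / 2).
assert (Hin : forall r, a <= r <= b -> I r).
{ unfold a, b. intros r Hr. apply HI, Rabs_def1; lra. }
assert (Hder : forall r, a <= r <= b -> is_derive st r (Derive st r) /\ 0 < Derive st r).
{ intros r Hr. destruct (quadric_facts _ _ _ _ HQ r (Hin r Hr)) as (_ & H1 & H2 & _). now split. }
assert (Hinc : forall p q, a <= p -> p < q -> q <= b -> st p < st q).
{ intros p q Hp Hpq Hq.
  destruct (MVT_gen st p q (Derive st)) as (c & Hc & E).
  - intros r Hr. rewrite Rmin_left, Rmax_right in Hr by lra. apply Hder. lra.
  - intros r Hr. rewrite Rmin_left, Rmax_right in Hr by lra.
    apply continuity_pt_filterlim. apply (ex_derive_continuous st).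
    exists (Derive st r). apply Hder. lra.
  - rewrite Rmin_left, Rmax_right in Hc by lra.
    destruct (Hder c) as [_ Hc']; [lra|]. nra. }
assert (Ha : st a < st s0) by (apply Hinc; unfold a, b; lra).
assert (Hb : st s0 < st b) by (apply Hinc; unfold a, b; lra).
assert (Hd : 0 < Rmin (st s0 - st a) (st b - st s0)) by (apply Rmin_pos; lra).
exists (mkposreal _ Hd). simpl. intros y Hy.
assert (H1 := Rmin_l (st s0 - st a) (st b - st s0)).
assert (H2 := Rmin_r (st s0 - st a) (st b - st s0)).
apply Rabs_def2 in Hy.
destruct (IVT_interv (fun r => st r - y) a b) as (s & Hs & E).
- intros r Hr. apply continuity_pt_filterlim.
  apply (ex_derive_continuous (fun r => st r - y)).
  apply (ex_derive_minus st (fun _ => y)).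
  + exists (Derive st r). now apply Hder.
  + apply ex_derive_const.
- unfold a, b; lra.
- lra.
- lra.
- exists s. split; [now apply Hin | lra].
Qed.

(** The box is chosen so small that [u + m * v] stays among the values of the
    arc-length parameter. *)
Lemma normal_coordinates_exist (vth st : R -> R) (c2 m s th : R) :
  quadric_curve I x t vth st c2 m -> locally s I ->
  exists (V : R * R -> Prop) (Y : R -> R -> H1) (zeta1 zeta2 : R -> R),
    normal_coordinates V Y zeta1 zeta2 /\
    patch_of_rot I x t vth st V Y /\
    exists u v, V (u, v) /\ Y u v = rot_surface x t s th.
Proof.
intros HQ Hloc. assert (Hs : I s) by exact (locally_singleton _ _ Hloc).
assert (Hm : m <> 0) by apply HQ.
destruct (quadric_x2_t _ _ _ _ HQ) as [k Hk]. destruct (Hk s Hs) as [Hx2 Htk].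
destruct (quadric_facts _ _ _ _ HQ s Hs) as (Hx & _).
destruct (ruled_through m k (st s) (x s) th Hx Hx2) as (u0 & v0 & Hsg & HY).
destruct (quadric_st_onto vth st c2 m s HQ Hloc) as [e He]. assert (Hep := cond_pos e).
assert (Hm1 : 0 < 1 + Rabs m) by (generalize (Rabs_pos m); lra).
set (d := Rmin 1 (e / (1 + Rabs m))).
assert (Hd : 0 < d) by (apply Rmin_pos; [lra | now apply Rdiv_lt_0_compat]).
assert (Hde : d * (1 + Rabs m) <= e).
{ apply Rle_trans with (e / (1 + Rabs m) * (1 + Rabs m)).
  - apply Rmult_le_compat_r; [lra | apply Rmin_r].
  - apply Req_le. field. lra. }
exists (box u0 v0 d), (ruled m k), (fun v => m * v), (fun _ => m ^ 2).
split; [|split].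
- apply ruled_normal_coordinates; auto. apply Rmin_l.
- apply (ruled_patch_of_rot vth st c2 m k); auto.
  intros u v [Hu Hv]. simpl in Hu, Hv. apply He. rewrite <- Hsg.
  replace (u + m * v - (u0 + m * v0)) with ((u - u0) + m * (v - v0)) by ring.
  apply Rle_lt_trans with (1 := Rabs_triang _ _). rewrite Rabs_mult.
  generalize (Rabs_pos m). nra.
- exists u0, v0. split.
  + split; simpl; rewrite Rminus_diag, Rabs_R0; exact Hd.
  + rewrite HY. unfold rot_surface. now rewrite Htk.
Qed.
End GeneratingCurve.

(** * The classification and the invariants *)

Theorem theorem2 (I : R -> Prop) (x t : R -> R)
    (hgam : generating_curve I x t) :
  (rot_p_minimal I x t <->
     ((exists k : R, forall s, I s -> t s = k) \/
      (exists (vth st : R -> R) (c2 m : R), quadric_curve I x t vth st c2 m))) /\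
  (forall k : R, (forall s, I s -> t s = k) ->
     forall s th, I s -> pz (rot_surface x t s th) = k) /\
  (forall (vth st : R -> R) (c2 m : R), quadric_curve I x t vth st c2 m ->
     exists E : R,
       (forall s, I s -> energy x t s = E) /\ E = m /\
       (forall s th, locally s I ->
          exists (V : R * R -> Prop) (Y : R -> R -> H1) (zeta1 zeta2 : R -> R),
            normal_coordinates V Y zeta1 zeta2 /\
            patch_of_rot I x t vth st V Y /\
            exists u v, V (u, v) /\ Y u v = rot_surface x t s th) /\
       (forall (V : R * R -> Prop) (Y : R -> R -> H1) (zeta1 zeta2 : R -> R),
          normal_coordinates V Y zeta1 zeta2 ->
          patch_of_rot I x t vth st V Y ->
          exists c : R, forall u v, V (u, v) ->
            zeta1 v = E * v + c /\ zeta2 v = c2)).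

Proof.
split; [|split].
- now apply classification.
- intros k Hk s th Hs. now apply Hk.
- intros vth st c2 m HQ. exists m. split; [|split; [reflexivity|split]].
  + intros s Hs. now apply (quadric_energy I x t hgam vth st c2 m).
  + intros s th Hs. now apply (normal_coordinates_exist I x t hgam vth st c2 m).
  + intros V Y zeta1 zeta2. now apply (normal_invariants I x t hgam vth st c2 m).
Qed.
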